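(* Let $\rho$ be a Drinfeld $\mathbb{F}_q[t]$-module of rank $r$ over $\overline{k}$ with $\rho_t=\theta+\kappa_1\tau+\cdots+\kappa_{r-1}\tau^{r-1}+\tau^r$, let $\omega_1,\dots,\omega_r$ be an $A$-basis of $\Lambda_\rho$, and let $s=[K_\rho:k]$. Suppose $u_1,\dots,u_n\in\mathbb{C}_\infty$ satisfy $\exp_\rho(u_i)=\alpha_i\in\overline{k}$ and $\dim_{K_\rho}\mathrm{Span}_{K_\rho}(\omega_1,\dots,\omega_r,u_1,\dots,u_n)=r/s+n$. Then the classes of the $t$-motives $X_{\alpha_1},\dots,X_{\alpha_n}$ in $\mathrm{Ext}^1(\mathbf{1},M_\rho)$ are linearly independent over $\mathrm{End}(M_\rho)$. Explicitly: for any $E_1,\dots,E_n\in\mathrm{Mat}_r(\overline{k}(t))$, not all zero, with $\Phi_\rho E_i=E_i^{(-1)}\Phi_\rho$ for each $i$, there is no row vector $\gamma\in\mathrm{Mat}_{1\times r}(\overline{k}(t))$ with $\gamma^{(-1)}\Phi_\rho+\sum_{i=1}^n\mathbf{h}_{\alpha_i}^{\mathrm{tr}}E_i=\gamma$, where $\mathbf{h}_\alpha^{\mathrm{tr}}=(\alpha,0,\dots,0)$.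
   Context: $\mathbb{F}_q$ is the field with $q$ elements, $\theta,t$ independent variables, $A=\mathbb{F}_q[\theta]$, $k=\mathbb{F}_q(\theta)$, $\mathbb{C}_\infty$ the completion of an algebraic closure of $\mathbb{F}_q((1/\theta))$, $\overline{k}$ the algebraic closure of $k$ in $\mathbb{C}_\infty$. For $f=\sum a_it^i\in\mathbb{C}_\infty((t))$, $f^{(n)}=\sum a_i^{q^n}t^i$ (entrywise on matrices; $c^{(n)}=c^{q^n}$ on constants). $\tau$ is the $q$-power Frobenius, $\mathbb{C}_\infty[\tau]$ the twisted polynomial ring acting by $(\sum c_i\tau^i)(x)=\sum c_ix^{q^i}$; $\rho$ is the $\mathbb{F}_q$-algebra map $\mathbb{F}_q[t]\to\overline{k}[\tau]$ determined by $\rho_t$. $\exp_\rho$ is the unique entire $\mathbb{F}_q$-linear series $z+\sum_{i\ge1}\alpha_iz^{q^i}$ with $\exp_\rho(\theta z)=\rho_t(\exp_\rho(z))$; $\Lambda_\rho=\ker\exp_\rho$ is free of rank $r$ over $A$; $K_\rho$ is the fraction field of $\{c\in\mathbb{C}_\infty:c\Lambda_\rho\subseteq\Lambda_\rho\}$. $\Phi_\rho\in\mathrm{Mat}_r(\overline{k}[t])$ has entries $1$ at $(i,i+1)$, $1\le i\le r-1$, last row $(t-\theta,-\kappa_1^{(-1)},\dots,-\kappa_{r-1}^{(-(r-1))})$, zeros elsewhere. Pre-$t$-motives are left modules over the twisted ring $\overline{k}(t)[\sigma,\sigma^{-1}]$ ($\sigma f=f^{(-1)}\sigma$) finite-dimensional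 over $\overline{k}(t)$. $M_\rho=\overline{k}(t)^r$ with $\sigma\mathbf{m}=\Phi_\rho\mathbf{m}$; $\mathbf{1}=\overline{k}(t)$ with $\sigma$ acting by $f\mapsto f^{(-1)}$; $X_\alpha=\overline{k}(t)^{r+1}$ with $\sigma$ given by $\begin{pmatrix}\Phi_\rho&0\\ \mathbf{h}_\alpha^{\mathrm{tr}}&1\end{pmatrix}$, an extension of $\mathbf{1}$ by $M_\rho$. Endomorphisms of $M_\rho$ are $\mathbf{m}\mapsto E\mathbf{m}$ with $\Phi_\rho E=E^{(-1)}\Phi_\rho$; the push-out of an extension with $\sigma$-matrix $\begin{pmatrix}\Phi_\rho&0\\ \mathbf{v}&1\end{pmatrix}$ along $E$ has matrix $\begin{pmatrix}\Phi_\rho&0\\ \mathbf{v}E&1\end{pmatrix}$, Baer sum adds the rows $\mathbf{v}$, and such an extension is trivial iff there is $\gamma\in\mathrm{Mat}_{1\times r}(\overline{k}(t))$ with $\gamma^{(-1)}\Phi_\rho+\mathbf{v}=\gamma$. *)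

(* Defs.v *)
From HB Require Import structures.
From mathcomp Require Import all_boot all_order all_algebra.
From mathcomp Require Import reals.
Set Implicit Arguments. Unset Strict Implicit. Unset Printing Implicit Defensive.
Import Order.TTheory GRing.Theory Num.Theory.
Local Open Scope ring_scope.

Section Cinf.
Variables (F : finFieldType) (C : closedFieldType) (R : realType).
Variables (iota : {rmorphism F -> C}) (theta : C) (abs : C -> R).

Definition qq : nat := #|F|.

Definition kev (a : {poly F}) : C := (map_poly iota a).[theta].

Definition in_k (x : C) : Prop :=
  exists a b : {poly F}, kev b != 0 /\ x = kev a / kev b.

Definition in_kbar (y : C) : Prop :=
  exists P : {poly {poly F}}, P != 0 /\ (map_poly kev P).[y] = 0.

Definition abs_lim (u : nat -> C) (l : C) : Prop :=
  forall e : R, 0 < e -> exists N, forall n, (N <= n)%N -> abs (u n - l) < e.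

(** (C, iota, theta, abs) is (a copy of) C_infinity: C is an algebraically
    closed field containing F_q and theta transcendental over F_q, abs is a
    non-archimedean absolute value with |theta| > 1 (hence trivial on F_q and
    equal to (a power of) the 1/theta-adic one on k), C is complete for abs,
    and kbar is dense in C (so C is the completion of kbar, i.e. of an
    algebraic closure of F_q((1/theta))). *)
Definition is_Cinf : Prop :=
  (forall p : {poly F}, p != 0 -> kev p != 0) /\
  (forall x, 0 <= abs x /\ (abs x = 0 <-> x = 0)) /\
  (forall x y, abs (x * y) = abs x * abs y) /\
  (forall x y, abs (x + y) <= Num.max (abs x) (abs y)) /\
  1 < abs theta /\
  (forall u : nat -> C,
      (forall e : R, 0 < e -> exists N, forall m n, (N <= m)%N -> (N <= n)%N ->
          abs (u m - u n) < e) -> exists l, abs_lim u l) /\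
  (forall x (e : R), 0 < e -> exists y, in_kbar y /\ abs (x - y) < e).

Definition rhoc (r : nat) (kappa : nat -> C) (j : nat) : C :=
  if j == 0%N then theta else if (j < r)%N then kappa j else if j == r then 1 else 0.

Definition exp_val (ec : nat -> C) (z w : C) : Prop :=
  abs_lim (fun n => \sum_(i < n) ec i * z ^+ (qq ^ i)) w.

Definition is_exp_coeffs (r : nat) (kappa : nat -> C) (ec : nat -> C) : Prop :=
  [/\ ec 0%N = 1,
      forall z, exists w, exp_val ec z w
    & forall z w, exp_val ec z w ->
        exp_val ec (theta * z) (\sum_(j < r.+1) rhoc r kappa j * w ^+ (qq ^ j))].

Definition in_Lambda (ec : nat -> C) (z : C) : Prop := exp_val ec z 0.

Definition is_A_basis (ec : nat -> C) (r : nat) (omega : 'I_r -> C) : Prop :=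
  [/\ forall i, in_Lambda ec (omega i),
      forall l, in_Lambda ec l ->
        exists a : 'I_r -> {poly F}, l = \sum_(i < r) kev (a i) * omega i
    & forall a : 'I_r -> {poly F},
        \sum_(i < r) kev (a i) * omega i = 0 -> forall i, a i = 0].

Definition in_End (ec : nat -> C) (c : C) : Prop :=
  forall l, in_Lambda ec l -> in_Lambda ec (c * l).

Definition in_Krho (ec : nat -> C) (x : C) : Prop :=
  exists c d, [/\ in_End ec c, in_End ec d, d != 0 & x = c / d].

End Cinf.

Section SubfieldLinAlg.
Variables (C : fieldType) (K : C -> Prop).

Definition K_lin_indep (d : nat) (b : 'I_d -> C) : Prop :=
  forall c : 'I_d -> C, (forall i, K (c i)) ->
    \sum_(i < d) c i * b i = 0 -> forall i, c i = 0.

Definition K_comb (d : nat) (b : 'I_d -> C) (x : C) : Prop :=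
  exists c : 'I_d -> C, (forall i, K (c i)) /\ x = \sum_(i < d) c i * b i.

Definition K_dim (S : C -> Prop) (dm : nat) : Prop :=
  exists b : 'I_dm -> C, [/\ forall i, S (b i), K_lin_indep b
                           & forall x, S x -> K_comb b x].
End SubfieldLinAlg.

Section Twist.
Variables (C : closedFieldType).

Definition Ct := {fraction {poly C}}.

Lemma qroot_ex (q : nat) (c : C) : exists x : C, x ^+ q.+1 == c.
Proof.
have [x Hx] := @GRing.solve_monicpoly C q.+1 (fun i => if i == 0%N then c else 0) isT.
exists x; apply/eqP; rewrite Hx big_ord_recl /= expr0 mulr1 big1 ?addr0 // => i _.
by rewrite mul0r.
Qed.

Definition qroot (q : nat) (c : C) : C := xchoose (qroot_ex q.-1 c).

End Twist.

Section Motives.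
Variables (F : finFieldType) (C : closedFieldType) (iota : {rmorphism F -> C})
  (theta : C).

Local Notation q := (qq F).
Local Notation "x %:F" := (@tofrac _ x).

Definition in_kbart (x : Ct C) : Prop :=
  exists p d : {poly C}, [/\ d != 0,
     forall i, in_kbar iota theta p`_i, forall i, in_kbar iota theta d`_i
   & x = p%:F / d%:F].

Definition twistm1 (f : Ct C) : Ct C -> Prop := fun g =>
  exists p d : {poly C}, [/\ d != 0, f = p%:F / d%:F
   & g = (map_poly (qroot q) p)%:F / (map_poly (qroot q) d)%:F].

Definition twistm1_mx m n (A B : 'M[Ct C]_(m, n)) : Prop :=
  forall i j, twistm1 (A i j) (B i j).

Definition in_kbart_mx m n (A : 'M[Ct C]_(m, n)) : Prop :=
  forall i j, in_kbart (A i j).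

Definition Phi_rho (r : nat) (kappa : nat -> C) : 'M[Ct C]_r :=
  \matrix_(i < r, j < r)
    if (i.+1 == j :> nat)%N then 1
    else if (i == r.-1 :> nat)%N then
      (if (j == 0 :> nat)%N then ('X - theta%:P)%:F
       else - ((iter j (qroot q) (kappa j))%:P)%:F)
    else 0.

Definition h_tr (r : nat) (alpha : C) : 'rV[Ct C]_r :=
  \row_(j < r) if (j == 0 :> nat)%N then (alpha%:P)%:F else 0.

End Motives.

(* Main.v *)
(** Write D = rho_t - t acting on C(t), with Frobenius acting on coefficients.
    A matrix E commuting with Phi_rho is determined by its first row w, and
    e = sum_j w_j^(j) tau^j (0 <= j < r) satisfies e D = D e' for some e'.

    All poles of the E_i and of gamma lie in the algebraic closure of F_q: the
    equations relating these functions to their twists make any other pole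
    generate an infinite Frobenius orbit of poles. Hence multiplication by a
    nonzero element of F_q[t], which is fixed by the twist, makes everything
    polynomial in t. Substituting rho_t for t (on the left) then kills the image
    of D and turns E_i into an operator eps_i in C[tau] commuting with rho_t,
    nonzero if E_i is, and turns the splitting of the extension into
    sum_i eps_i(alpha_i) = 0.

    If b_i is the constant coefficient of eps_i, then eps_i(exp z) - exp(b_i z)
    is O(z^2) at 0 and is carried by z |-> theta z to its image under rho_t; this
    forces it to vanish. So b_i lies in End(Lambda), b_i is nonzero if E_i is, and
    exp(sum_i b_i u_i) = 0. This is a K_rho-linear relation between the u_i
    modulo the span of the periods, against the dimension hypothesis. *)
Require Import Defs.
From HB Require Import structures.
From mathcomp Require Import all_boot all_order all_algebra all_field.
From mathcomp Require Import boolp reals ring lra zify.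
Set Implicit Arguments. Unset Strict Implicit. Unset Printing Implicit Defensive.
Import Order.TTheory GRing.Theory Num.Theory.
Local Open Scope ring_scope.

(** * Linear algebra over a subfield given by a predicate *)

Section SubfieldElimination.
Variables (C : fieldType) (K : C -> Prop).
Hypotheses (K0 : K 0) (K1 : K 1) (KB : forall x y, K x -> K y -> K (x - y))
  (KM : forall x y, K x -> K y -> K (x * y)) (KV : forall x, K x -> K x^-1).

Lemma subfield_opp x : K x -> K (- x).
Proof. by move=> Kx; rewrite -sub0r; apply: KB. Qed.

Lemma subfield_add x y : K x -> K y -> K (x + y).
Proof. by move=> Kx Ky; rewrite -[y]opprK; apply: KB => //; apply: subfield_opp. Qed.

Lemma subfield_sum (I : finType) (P : pred I) (f : I -> C) :
  (forall i, K (f i)) -> K (\sum_(i | P i) f i).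
Proof. by move=> Kf; elim/big_ind: _ => // x y; apply: subfield_add. Qed.

(** Gaussian elimination on the last column: it uses only field operations on the entries, so the
    kernel vector it produces has coordinates in [K] and not merely in [C]. *)
Lemma subfield_left_kernel_ord m r (A : 'M[C]_(m, r)) :
  (r < m)%N -> (forall i j, K (A i j)) ->
  exists v : 'I_m -> C, [/\ forall i, K (v i), exists i, v i != 0
                          & forall j, \sum_i v i * A i j = 0].
Proof.
elim: r m A => [|r IH] [|m] A // ltrm KA.
  exists (fun=> 1); split => // [|[]//]; exists ord0; exact: oner_neq0.
have [/existsP[i0 p0]|/existsPn p0] := boolP [exists i, A i ord_max != 0]; last first.
  have [|i j|v [Kv v0 vA]] := IH m.+1 (\matrix_(i, j) A i (lift ord_max j)).
  - exact: ltnW.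
  - by rewrite mxE.
  - exists v; split=> // j; case: (unliftP ord_max j) => [j'|] ->.
      by rewrite -[RHS](vA j'); apply: eq_bigr => i _; rewrite mxE.
    by apply: big1 => i _; have := p0 i; rewrite negbK => /eqP ->; rewrite mulr0.
set p := A i0 ord_max in p0; pose c i := A (lift i0 i) ord_max / p.
have [|i j|v [Kv [i1 v0] vA]] :=
  IH m (\matrix_(i, j) (A (lift i0 i) (lift ord_max j) - c i * A i0 (lift ord_max j))).
- by [].
- by rewrite mxE; apply: KB => //; apply: KM => //; apply: KM => //; apply: KV; exact: KA.
(* The coordinate on the pivot row [i0] undoes the subtraction of [c i] times that row from the
   others. *)
exists (fun i => if unlift i0 i is Some i' then v i' else - \sum_i v i * c i).
split.
- move=> i; case: unliftP => [i' _|_] //; apply: subfield_opp; apply: subfield_sum => i'.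
  by apply: KM => //; apply: KM => //; apply: KV; exact: KA.
- by exists (lift i0 i1); rewrite liftK.
move=> j; rewrite (bigD1_ord i0) //= unlift_none.
rewrite [X in _ + X](eq_bigr (fun i => v i * A (lift i0 i) j)); last first.
  by move=> i _; rewrite liftK.
rewrite mulNr mulr_suml addrC; apply/eqP; rewrite subr_eq0; apply/eqP.
case: (unliftP ord_max j) => [j'|] ->; last first.
  by apply: eq_bigr => i _; rewrite -mulrA /c divfK.
apply/eqP; rewrite -subr_eq0 -sumrB -[X in _ == X](vA j'); apply/eqP.
by apply: eq_bigr => i _; rewrite mxE mulrBr -[in LHS]mulrA.
Qed.

Lemma subfield_left_kernel (I J : finType) (A : I -> J -> C) :
  (#|J| < #|I|)%N -> (forall i j, K (A i j)) ->
  exists v : I -> C, [/\ forall i, K (v i), exists i, v i != 0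
                       & forall j, \sum_i v i * A i j = 0].
Proof.
move=> ltJI KA.
have [|i j|v [Kv [i0 v0] vA]] := @subfield_left_kernel_ord #|I| #|J|
  (\matrix_(i, j) A (enum_val i) (enum_val j)).
- by [].
- by rewrite mxE.
exists (fun i => v (enum_rank i)); split=> //.
  by exists (enum_val i0); rewrite enum_valK.
move=> j; rewrite -[RHS](vA (enum_rank j)) (reindex (@enum_val I predT)) /=.
  by apply: eq_bigr => i _; rewrite mxE enum_valK enum_rankK.
by apply: onW_bij; apply: enum_val_bij.
Qed.

Definition fin_comb (J : finType) (x : J -> C) (y : C) : Prop :=
  exists c : J -> C, (forall j, K (c j)) /\ y = \sum_j c j * x j.

Lemma fin_comb_gen (J : finType) (x : J -> C) c j : K c -> fin_comb x (c * x j).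
Proof.
move=> Kc; exists (fun i => if i == j then c else 0); split=> [i|]; first by case: ifP.
by rewrite (bigD1 j) //= eqxx big1 ?addr0 // => i /negPf ->; rewrite mul0r.
Qed.

Lemma fin_combD (J : finType) (x : J -> C) y z :
  fin_comb x y -> fin_comb x z -> fin_comb x (y + z).
Proof.
move=> [c [Kc ->]] [d [Kd ->]]; exists (fun j => c j + d j); split=> [j|].
  exact: subfield_add.
by rewrite -big_split; apply: eq_bigr => j _; rewrite mulrDl.
Qed.

Lemma fin_comb_sum (I J : finType) (x : J -> C) (y : I -> C) :
  (forall i, fin_comb x (y i)) -> fin_comb x (\sum_i y i).
Proof.
move=> xy; elim/big_ind: _ => //; last exact: fin_combD.
by exists (fun=> 0); split=> //; rewrite big1 // => j _; rewrite mul0r.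
Qed.

(** Steinitz bound: with more [b]'s than [x]'s, a left kernel vector of the coefficient matrix would
    be a nontrivial relation among the [b]'s. *)
Lemma indep_card_le (I J : finType) (b : I -> C) (x : J -> C) :
  (forall c : I -> C, (forall i, K (c i)) -> \sum_i c i * b i = 0 -> forall i, c i = 0) ->
  (forall i, fin_comb x (b i)) -> (#|I| <= #|J|)%N.
Proof.
move=> indb /fin_all_exists[A bA].
have KA i j : K (A i j) by case: (bA i).
have bE i : b i = \sum_j A i j * x j by case: (bA i).
rewrite leqNgt; apply/negP => lt.
have [v [Kv [i0 v0] vA]] := subfield_left_kernel lt KA.
case/eqP: v0; apply: indb => //.
under eq_bigr => i _ do rewrite bE mulr_sumr.
rewrite exchange_big big1 //= => j _.
by under eq_bigr => i _ do rewrite mulrA; rewrite -mulr_suml vA mul0r.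
Qed.

End SubfieldElimination.

Lemma poly_eq0_injective_roots (C : idomainType) (p : {poly C}) (z_ : nat -> C) :
  injective z_ -> (forall i, root p (z_ i)) -> p = 0.
Proof.
move=> z_inj rp; apply: contraTeq isT => p0; suff : (size p < size p)%N by rewrite ltnn.
rewrite -{1}(size_iota 0 (size p)) -(size_map z_); apply: max_poly_roots => //.
  by apply/allP => _ /mapP[j _ ->]; apply: rp.
by rewrite map_inj_uniq ?iota_uniq.
Qed.

(** * Frobenius twists and poles of rational functions *)

Section QPower.
Variables (F : finFieldType) (C : closedFieldType) (iota : {rmorphism F -> C}).

Lemma qq_gt1 : (1 < qq F)%N. Proof. exact: finNzRing_gt1. Qed.

Lemma qq_gt0 : (0 < qq F)%N. Proof. exact: ltnW qq_gt1. Qed.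

Lemma pnat_qq : [pchar C].-nat (qq F).
Proof.
have [p p_pr pF] := finPcharP F.
have pC : p \in [pchar C] by exact: rmorph_pchar iota _ pF.
rewrite (eq_pnat _ (pcharf_eq pC)).
have -> : qq F = (p ^ logn p #|F|)%N by exact: (card_pprimeChar pF).
by rewrite pnatX pnat_id.
Qed.

Lemma exprD_qq (x y : C) : (x + y) ^+ qq F = x ^+ qq F + y ^+ qq F.
Proof. exact: exprDn_pchar pnat_qq. Qed.

(* The unused argument keys the canonical structures below: [iota] is what forces
   the characteristic of [C]. *)
Definition frob (_ : {rmorphism F -> C}) (x : C) : C := x ^+ qq F.

Definition qrt (_ : {rmorphism F -> C}) : C -> C := qroot (qq F).

Lemma qrtE x : qrt iota x ^+ qq F = x.
Proof.
rewrite -[X in _ ^+ X](prednK qq_gt0).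
exact/eqP/(xchooseP (qroot_ex (qq F).-1 x)).
Qed.

Lemma frob_is_zmod_morphism : zmod_morphism (frob iota).
Proof. by move=> x y; apply/eqP; rewrite eq_sym subr_eq /frob -exprD_qq subrK. Qed.

Lemma frob_is_monoid_morphism : monoid_morphism (frob iota).
Proof. by split=> [|x y]; rewrite /frob ?expr1n ?exprMn. Qed.

HB.instance Definition _ := GRing.isZmodMorphism.Build C C (frob iota) frob_is_zmod_morphism.
HB.instance Definition _ := GRing.isMonoidMorphism.Build C C (frob iota) frob_is_monoid_morphism.

Lemma frob_inj : injective (frob iota). Proof. exact: fmorph_inj. Qed.

Lemma qrtK : cancel (qrt iota) (frob iota). Proof. exact: qrtE. Qed.

Lemma frobK : cancel (frob iota) (qrt iota).
Proof. by move=> x; apply: frob_inj; rewrite qrtK. Qed.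

Lemma qrt_is_zmod_morphism : zmod_morphism (qrt iota).
Proof. by move=> x y; apply: frob_inj; rewrite qrtK rmorphB /= !qrtK. Qed.

Lemma qrt_is_monoid_morphism : monoid_morphism (qrt iota).
Proof. by split=> [|x y]; apply: frob_inj; rewrite ?qrtK ?rmorph1 ?rmorphM /= ?qrtK. Qed.

HB.instance Definition _ := GRing.isZmodMorphism.Build C C (qrt iota) qrt_is_zmod_morphism.
HB.instance Definition _ := GRing.isMonoidMorphism.Build C C (qrt iota) qrt_is_monoid_morphism.

Lemma map_poly_qrtK : cancel (map_poly (qrt iota)) (map_poly (frob iota)).
Proof. by move=> p; apply/polyP=> i; rewrite !coef_map /= qrtK. Qed.

(** Frobenius fixes $\mathbb{F}_q$. This is why multipliers taken from $\mathbb{F}_q[t]$ pass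
    through the twist. *)
Lemma map_poly_qrt_iota (a : {poly F}) :
  map_poly (qrt iota) (map_poly iota a) = map_poly iota a.
Proof.
apply/polyP=> i; rewrite !coef_map; apply: frob_inj.
by rewrite qrtK /= /frob -rmorphXn /= /qq expf_card.
Qed.

Lemma iter_frob j x : iter j (frob iota) x = x ^+ (qq F ^ j).
Proof. by elim: j => [|j IH] /=; rewrite ?expn0 ?expr1 // IH /frob -exprM expnSr. Qed.

Lemma iter_qrtK j : cancel (iter j (qrt iota)) (iter j (frob iota)).
Proof. by move=> x; elim: j => // j IH; rewrite [iter _ (frob _) _]iterSr /= qrtK. Qed.

Lemma iter_frobK j : cancel (iter j (frob iota)) (iter j (qrt iota)).
Proof. by move=> x; elim: j => // j IH; rewrite [iter _ (qrt _) _]iterSr /= frobK. Qed.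

Lemma exprD_qqX j (x y : C) : (x + y) ^+ (qq F ^ j) = x ^+ (qq F ^ j) + y ^+ (qq F ^ j).
Proof. by apply: exprDn_pchar; rewrite pnatX pnat_qq. Qed.

(* [periodic z] says that [z] is algebraic over F_q. *)
Definition periodic (z : C) : Prop := exists2 m, (0 < m)%N & iter m (frob iota) z = z.

Lemma periodic_annihilator z : periodic z ->
  exists2 a : {poly F}, a != 0 & root (map_poly iota a) z.
Proof.
case=> m m0 zm; have q1 : (1 < qq F ^ m)%N by rewrite -(exp1n m) ltn_exp2r ?qq_gt1.
exists ('X^(qq F ^ m) - 'X).
  by rewrite -size_poly_gt0 size_polyDl ?size_polyXn // size_polyN size_polyX ltnS.
by rewrite rmorphB /= map_polyXn map_polyX rootE !hornerE -iter_frob zm subrr.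
Qed.

Section Regular.
Local Notation "x %:F" := (@tofrac _ x).

(** Absence of a pole at [z], stated through some fraction so that no reduced form has to be
    chosen. *)
Definition regular (z : C) (f : Ct C) : Prop :=
  exists p d : {poly C}, d.[z] != 0 /\ f = p%:F / d%:F.

Lemma nonroot_neq0 z (d : {poly C}) : d.[z] != 0 -> d != 0.
Proof. by apply: contraNneq => ->; rewrite horner0. Qed.

Lemma regular_poly z p : regular z p%:F.
Proof. by exists p, 1; rewrite hornerC oner_neq0 tofrac1 divr1. Qed.

Lemma regularD z f g : regular z f -> regular z g -> regular z (f + g).
Proof.
case=> [p [d [d0 ->]]] [p' [d' [d'0 ->]]].
exists (p * d' + p' * d), (d * d'); split; first by rewrite hornerM mulf_neq0.
by rewrite addf_div ?tofrac_eq0 ?(nonroot_neq0 d0) ?(nonroot_neq0 d'0) // rmorphD !rmorphM.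
Qed.

Lemma regularM z f g : regular z f -> regular z g -> regular z (f * g).
Proof.
case=> [p [d [d0 ->]]] [p' [d' [d'0 ->]]].
exists (p * p'), (d * d'); split; first by rewrite hornerM mulf_neq0.
by rewrite mulf_div !rmorphM.
Qed.

Lemma regularN z f : regular z f -> regular z (- f).
Proof. by case=> [p [d [d0 ->]]]; exists (- p), d; rewrite rmorphN mulNr. Qed.

Lemma regular_sum z (I : finType) (P : pred I) (f : I -> Ct C) :
  (forall i, P i -> regular z (f i)) -> regular z (\sum_(i | P i) f i).
Proof.
move=> rf; elim/big_ind: _ => //; last exact: regularD.
by rewrite -tofrac0; apply: regular_poly.
Qed.

Lemma frac_eq (p d p' d' : {poly C}) : d != 0 -> d' != 0 ->
  p%:F / d%:F = p'%:F / d'%:F <-> p * d' = p' * d.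
Proof.
move=> d0 d'0; have e : (p%:F / d%:F == p'%:F / d'%:F) = (p * d' == p' * d).
  by rewrite eqr_div ?tofrac_eq0 // -!rmorphM tofrac_eq.
by split=> /eqP h; apply/eqP; rewrite ?e // -e.
Qed.

Lemma twistm1E (f g : Ct C) : twistm1 F f g <-> exists p d : {poly C},
  [/\ d != 0, f = p%:F / d%:F
   & g = (map_poly (qrt iota) p)%:F / (map_poly (qrt iota) d)%:F].
Proof. by []. Qed.

(** The twist does not depend on the chosen fraction: twisting coefficients preserves the
    cross-multiplied identity between two fractions. *)
Lemma twistm1_frac f g p d : twistm1 F f g -> d != 0 -> f = p%:F / d%:F ->
  g = (map_poly (qrt iota) p)%:F / (map_poly (qrt iota) d)%:F.
Proof.
case/twistm1E=> [p' [d' [d'0 -> ->]]] d0 /frac_eq e.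
by apply/frac_eq; rewrite ?map_poly_eq0 // -!rmorphM /= e.
Qed.

Lemma twistm1_frac_inv f g p d : twistm1 F f g -> d != 0 -> g = p%:F / d%:F ->
  f = (map_poly (frob iota) p)%:F / (map_poly (frob iota) d)%:F.
Proof.
case/twistm1E=> [p' [d' [d'0 -> ->]]] d0 /frac_eq e.
apply/frac_eq; rewrite ?map_poly_eq0 // -(map_poly_qrtK p') -(map_poly_qrtK d') -!rmorphM /=.
by rewrite e // map_poly_eq0.
Qed.

Lemma regular_twistm1 z f g : twistm1 F f g -> regular z f <-> regular (qrt iota z) g.
Proof.
move=> fg; split=> [] [p [d [d0 e]]].
  have e' := twistm1_frac fg (nonroot_neq0 d0) e.
  by eexists _, _; split; last exact: e'; rewrite horner_map fmorph_eq0.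
have e' := twistm1_frac_inv fg (nonroot_neq0 d0) e.
by eexists _, _; split; last exact: e'; rewrite -[z]qrtK horner_map fmorph_eq0.
Qed.

(** Induction on the degree of [d], removing one root at a time. A periodic root is absorbed by a
    multiplier from $\mathbb{F}_q[t]$; any other root cancels against the numerator. *)
Lemma clear_denominator (p d : {poly C}) : d != 0 ->
  (forall z, ~ periodic z -> regular z (p%:F / d%:F)) ->
  exists2 a : {poly F}, a != 0 & exists P, (map_poly iota a)%:F * (p%:F / d%:F) = P%:F.
Proof.
have [n] := ubnP (size d); elim: n p d => // n IH p d szd d0 reg_pd.
have [/eqP/size_poly1P[c c0 dE]|] := eqVneq (size d) 1%N.
  exists 1; first exact: oner_neq0.
  exists (c^-1 *: p); rewrite rmorph1 mul1r -[RHS]divr1 -tofrac1.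
  by apply/frac_eq; rewrite ?oner_neq0 ?polyC_eq0 // dE mulr1 mulrC mul_polyC scalerA divff ?scale1r.
case/closed_rootP=> z /factor_theorem[d1 dE].
have X0 : 'X - z%:P != 0 by rewrite polyXsubC_eq0.
have d10 : d1 != 0 by apply: contraNneq d0; rewrite dE => ->; rewrite mul0r.
have szd1 : (size d1 < n)%N.
  by move: szd; rewrite dE size_Mmonic ?monicXsubC // size_XsubC addn2.
have [zp|zp] := pselect (periodic z).
  have [a1 a10 /factor_theorem[h hE]] := periodic_annihilator zp.
  have e : (map_poly iota a1)%:F * (p%:F / d%:F) = (p * h)%:F / d1%:F.
    rewrite mulrA -rmorphM; apply/frac_eq => //; rewrite hE dE; ring.
  have [||w /reg_pd rw|a a0 [P aP]] := IH (p * h) d1 => //.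
    by rewrite -e; apply: regularM => //; apply: regular_poly.
  exists (a * a1); first by rewrite mulf_neq0.
  by exists P; rewrite !rmorphM -mulrA e.
(* Regularity at the root [z] of [d] forces [p] to vanish there, so the factor ['X - z%:P]
   cancels. *)
have [p2 [d2 [d20 e]]] := reg_pd z zp.
have {}e : p * d2 = p2 * d by apply/frac_eq => //; apply: nonroot_neq0 d20.
have /factor_theorem[p1 pE] : root p z.
  have /eqP := congr1 (horner^~ z) e; rewrite !hornerM dE hornerM hornerXsubC subrr !mulr0.
  by rewrite mulf_eq0 (negPf d20) orbF.
have {}e : p%:F / d%:F = p1%:F / d1%:F by apply/frac_eq => //; rewrite pE dE; ring.
by rewrite e; apply: IH => // w /reg_pd; rewrite e.
Qed.

Definition regular_mx z m n (A : 'M[Ct C]_(m, n)) := forall i j, regular z (A i j).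

Definition presented m n (A : 'M[Ct C]_(m, n)) :=
  forall i j, exists p d : {poly C}, d != 0 /\ A i j = p%:F / d%:F.

(** The product [D] of all the denominators has finitely many roots, so an injective sequence must
    leave them. *)
Lemma regular_eventually m n (A : 'M[Ct C]_(m, n)) (z_ : nat -> C) :
  presented A -> injective z_ -> exists i, regular_mx (z_ i) A.
Proof.
move=> prA z_inj.
have /fin_all_exists[d dP] : forall ij : 'I_m * 'I_n, exists d : {poly C},
    d != 0 /\ exists p : {poly C}, A ij.1 ij.2 = p%:F / d%:F.
  by case=> i j; have [p [d [d0 e]]] := prA i j; exists d; split=> //; exists p.
pose D := \prod_ij d ij.
have D0 : D != 0 by apply/prodf_neq0 => ij _; case: (dP ij).
have [i iP] : exists i, ~~ root D (z_ i).
  apply: contrapT => /forallNP rD.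
  move/eqP: D0; apply; apply: (poly_eq0_injective_roots z_inj) => i.
  exact/negPn/negP/rD.
exists i => k l; have [d0 [p ->]] := dP (k, l); exists p, (d (k, l)); split=> //.
by apply: contra iP => /eqP dz; rewrite rootE /D horner_prod (bigD1 (k, l)) //= dz mul0r.
Qed.

(** Otherwise a pole at [z_ 0] would propagate to every [z_ i], giving infinitely many poles. *)
Lemma regular_chain m n (A : 'M[Ct C]_(m, n)) (z_ : nat -> C) :
  presented A -> injective z_ ->
  (forall i, regular_mx (z_ i.+1) A -> regular_mx (z_ i) A) -> regular_mx (z_ 0%N) A.
Proof.
move=> prA z_inj step; have [i] := regular_eventually prA z_inj.
by elim: i => // i IH /step.
Qed.

Lemma iter_frob_nonperiodic z : ~ periodic z -> injective (fun i => iter i (frob iota) z).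
Proof.
move=> zp i j; wlog lij : i j / (i < j)%N => [th|].
  by case: (ltngtP i j) => // [ij /th ->|ij /esym/th ->].
rewrite -(subnKC (ltnW lij)) iterD => /(can_inj (iter_frobK i)) e.
by case: zp; exists (j - i)%N; rewrite ?subn_gt0.
Qed.

Lemma iter_qrt_nonperiodic z : ~ periodic z -> injective (fun i => iter i (qrt iota) z).
Proof.
move=> zp i j; wlog lij : i j / (i < j)%N => [th|].
  by case: (ltngtP i j) => // [ij /th ->|ij /esym/th ->].
move=> /= e; case: zp; exists (j - i)%N; rewrite ?subn_gt0 //.
rewrite -{1}[z](iter_qrtK i) e.
rewrite -iterD subnK 1?ltnW // iter_qrtK //.
Qed.

End Regular.

End QPower.

(** * Multiplication by companion-type matrices *)

Section ShiftMatrix.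
Variables (R : comNzRingType) (m : nat) (h : R) (k : nat -> R).

(** The shape of $\Phi_\rho$ over an arbitrary ring, so that the same formulas serve over $C(t)$ and
    over $C[t]$. *)
Definition shift_mx : 'M[R]_m.+1 := \matrix_(i, j)
  if (i.+1 == j :> nat)%N then 1 else
  if (i == m :> nat)%N then (if (j == 0 :> nat)%N then h else - k j) else 0.

(** Here [lift ord_max i] is the index i and [lift ord0 i] the index i+1: left multiplication moves
    the rows up by one. *)
Lemma shift_mx_row n (A : 'M_(m.+1, n)) (i : 'I_m) j :
  (shift_mx *m A) (lift ord_max i) j = A (lift ord0 i) j.
Proof.
rewrite mxE (bigD1 (lift ord0 i)) //= mxE lift_max /= eqxx mul1r big1 ?addr0 // => l ne.
rewrite mxE lift_max; case: eqP => [e|_].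
  by case/eqP: ne; apply: val_inj; rewrite /= -e.
by rewrite (ltn_eqF (ltn_ord i)) mul0r.
Qed.

Lemma shift_mx_row_max n (A : 'M_(m.+1, n)) j :
  (shift_mx *m A) ord_max j = h * A ord0 j - \sum_(i < m) k i.+1 * A (lift ord0 i) j.
Proof.
rewrite mxE big_ord_recl !mxE /= eqxx -sumrN; congr (_ + _).
apply: eq_bigr => i _; by rewrite mxE /= /bump /= add1n eqSS (gtn_eqF (ltn_ord i)) eqxx mulNr.
Qed.

Lemma shift_mx_col0 n (A : 'M_(n, m.+1)) i :
  (A *m shift_mx) i ord0 = A i ord_max * h.
Proof.
rewrite mxE (bigD1 ord_max) //= mxE /= eqxx big1 ?addr0 // => l ne.
rewrite mxE /=; case: eqP => [e|]; last by rewrite mulr0.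
by case/eqP: ne; apply: val_inj.
Qed.

Lemma shift_mx_col n (A : 'M_(n, m.+1)) i (j : 'I_m) :
  (A *m shift_mx) i (lift ord0 j) = A i (lift ord_max j) - A i ord_max * k j.+1.
Proof.
rewrite mxE (bigD1 ord_max) //= (bigD1 (lift ord_max j)) /=; last by rewrite eq_sym neq_lift.
rewrite !mxE lift_max /= /bump /= !add1n !eqSS (gtn_eqF (ltn_ord j)) !eqxx mulr1 mulrN.
rewrite big1 ?addr0 1?addrC // => l /andP[ne1 ne2].
rewrite mxE /= /bump /= add1n eqSS; case: eqP => [e|_].
  by case/eqP: ne2; apply: val_inj; exact: etrans e (esym (lift_max j)).
case: eqP => [e|_]; last by rewrite mulr0.
by case/eqP: ne1; apply: val_inj.
Qed.

End ShiftMatrix.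

(** * Denominators of endomorphisms and of splittings *)

Section Denominators.
Variables (F : finFieldType) (C : closedFieldType) (iota : {rmorphism F -> C}).
Variables (theta : C) (kappa : nat -> C) (m : nat).
Hypothesis theta_nonperiodic : ~ periodic iota theta.

Local Notation "x %:F" := (@tofrac _ x).
Local Notation Phi := (Phi_rho F theta m.+1 kappa).
Local Notation kq := (fun j => (iter j (qrt iota) (kappa j))%:P%:F).
Local Notation qrtp := (map_poly (qrt iota)).

Definition Phi_poly : 'M[{poly C}]_m.+1 :=
  shift_mx m ('X - theta%:P) (fun j => (iter j (qrt iota) (kappa j))%:P).

Lemma Phi_rhoE : Phi = shift_mx m ('X - theta%:P)%:F kq.
Proof. by apply/matrixP=> i j; rewrite !mxE. Qed.

Lemma map_Phi_poly : map_mx (@tofrac _) Phi_poly = Phi.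
Proof.
apply/matrixP=> i j; rewrite !mxE; case: ifP => _; first exact: tofrac1.
by case: ifP => _; [case: ifP => // _; rewrite rmorphN | exact: tofrac0].
Qed.

Lemma regular_twistm1_mx z a b (A B : 'M[Ct C]_(a, b)) : twistm1_mx F A B ->
  regular_mx z A <-> regular_mx (qrt iota z) B.
Proof. by move=> AB; split=> h i j; apply/(regular_twistm1 iota z (AB i j)). Qed.

Lemma regular_mulmx z a b c (A : 'M[Ct C]_(a, b)) (B : 'M_(b, c)) :
  regular_mx z A -> regular_mx z B -> regular_mx z (A *m B).
Proof. by move=> rA rB i j; rewrite mxE; apply: regular_sum => k _; apply: regularM. Qed.

Lemma regular_Phi z : regular_mx z Phi.
Proof. by rewrite -map_Phi_poly => i j; rewrite mxE; apply: regular_poly. Qed.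

Lemma regular_invXsubC z : z != theta -> regular z (('X - theta%:P)%:F)^-1.
Proof.
move=> zt; exists 1, ('X - theta%:P); split; last by rewrite tofrac1 mul1r.
by rewrite hornerXsubC subr_eq0.
Qed.

Lemma tofrac_XsubC_neq0 : ('X - theta%:P)%:F != 0.
Proof. by rewrite tofrac_eq0 polyXsubC_eq0. Qed.

(** $\Phi_\rho$ is invertible away from $t=\theta$. The rows of [A] other than row 0 are themselves
    rows of the product; row 0 comes from the last row of the product after division by
    $t-\theta$. *)
Lemma regular_Phi_mul z n (A : 'M_(m.+1, n)) : z != theta ->
  regular_mx z (Phi *m A) -> regular_mx z A.
Proof.
move=> zt; rewrite Phi_rhoE => rPA.
have rA (i : 'I_m) j : regular z (A (lift ord0 i) j) 
  by rewrite -(shift_mx_row ('X - theta%:P)%:F kq A i j).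
move=> i j; case: (unliftP ord0 i) => [i'|] -> //.
have -> : A ord0 j = (('X - theta%:P)%:F)^-1 *
    ((('X - theta%:P)%:F * A ord0 j -
     \sum_(i < m) (iter i.+1 (qrt iota) (kappa i.+1))%:P%:F * A (lift ord0 i) j)
    + \sum_(i < m) (iter i.+1 (qrt iota) (kappa i.+1))%:P%:F * A (lift ord0 i) j).
  by rewrite subrK mulKf // tofrac_XsubC_neq0.
apply: regularM; first exact: regular_invXsubC.
apply: regularD; first by rewrite -(shift_mx_row_max _ kq).
by apply: regular_sum => k _; apply: regularM => //; apply: regular_poly.
Qed.

(** The same inversion on columns: column 0 of the product yields the last column of [A] after
    division by $t-\theta$, and this corrects the other columns. *)
Lemma regular_mul_Phi z n (A : 'M_(n, m.+1)) : z != theta ->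
  regular_mx z (A *m Phi) -> regular_mx z A.
Proof.
move=> zt; rewrite Phi_rhoE => rAP.
have rmax i : regular z (A i ord_max).
  rewrite -(mulfK tofrac_XsubC_neq0 (A i ord_max)); apply: regularM; last exact: regular_invXsubC.
  by have := rAP i ord0; rewrite shift_mx_col0.
move=> i j; case: (unliftP ord_max j) => [j'|] -> //.
have := rAP i (lift ord0 j'); rewrite shift_mx_col => r1.
rewrite -(subrK (A i ord_max * (iter j'.+1 (qrt iota) (kappa j'.+1))%:P%:F) (A i _)).
by apply: regularD => //; apply: regularM => //; apply: regular_poly.
Qed.

Lemma twistm1_presented a b (A B : 'M[Ct C]_(a, b)) : twistm1_mx F A B -> presented A.
Proof. by move=> AB i j; have [p [d [d0 -> _]]] := AB i j; exists p, d. Qed.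

(* The pole set of [E] is stable under z |-> z^q away from [theta], and under
   z |-> z^(1/q) as soon as z^(1/q) is not [theta]; a nonperiodic pole would thus
   generate an infinite forward or backward Frobenius orbit of poles. *)
Lemma endomorphism_regular (E Em1 : 'M[Ct C]_m.+1) z :
  twistm1_mx F E Em1 -> Phi *m E = Em1 *m Phi -> ~ periodic iota z -> regular_mx z E.
Proof.
move=> EEm1 PhiE zp; have prE := twistm1_presented EEm1.
have up w : w != theta -> regular_mx (frob iota w) E -> regular_mx w E.
  move=> wt /(regular_twistm1_mx _ EEm1); rewrite frobK => rE.
  by apply: regular_Phi_mul => //; rewrite PhiE; apply: regular_mulmx => //; apply: regular_Phi.
have down w : qrt iota w != theta -> regular_mx (qrt iota w) E -> regular_mx w E.
  move=> wt rE; apply/(regular_twistm1_mx _ EEm1); apply: regular_mul_Phi => //.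
  by rewrite -PhiE; apply: regular_mulmx => //; apply: regular_Phi.
(* If [theta] lies on the forward orbit of [z], the backward orbit is followed instead: meeting
   [theta] there as well would make it periodic. *)
have [[j jz]|/forallNP zt] := pselect (exists j, iter j (frob iota) z = theta).
  apply: (regular_chain prE (iter_qrt_nonperiodic zp)) => i; apply: down.
  apply: contra_not_neq theta_nonperiodic => e.
  exists (j + i.+1)%N; first by rewrite addnS.
  by rewrite iterD -e -[in LHS]iterS iter_qrtK jz.
apply: (regular_chain prE (iter_frob_nonperiodic zp)) => i; apply: up.
exact/eqP/zt.
Qed.

(** A pole of [g] where [v] is regular is a pole of [gm1], since $\Phi_\rho$ has polynomial entries,
    hence gives a pole of [g] at the q-th power. Poles thus climb the forward orbit, with no
    exception at [theta]. *)
Lemma solution_regular (g gm1 v : 'rV[Ct C]_m.+1) z :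
  twistm1_mx F g gm1 -> gm1 *m Phi + v = g ->
  (forall w, ~ periodic iota w -> regular_mx w v) -> ~ periodic iota z -> regular_mx z g.
Proof.
move=> gg ge rv zp.
apply: (regular_chain (twistm1_presented gg) (iter_frob_nonperiodic zp)) => i.
move=> /(regular_twistm1_mx _ gg); rewrite iterS frobK => rg k l.
rewrite -ge mxE; apply: regularD; first exact: (regular_mulmx rg (@regular_Phi _)).
apply: rv => -[j j0 e]; apply: zp; exists j => //.
by apply: (can_inj (iter_frobK iota i)); rewrite -!iterD addnC iterD.
Qed.

Lemma clear_denominators_mx a b (A : 'M[Ct C]_(a, b)) :
  presented A -> (forall z, ~ periodic iota z -> regular_mx z A) ->
  exists2 c : {poly F}, c != 0 &
    exists P : 'M[{poly C}]_(a, b), (map_poly iota c)%:F *: A = map_mx (@tofrac _) P.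
Proof.
move=> prA rA.
have /fin_all_exists[c cP] : forall ij : 'I_a * 'I_b, exists c : {poly F}, c != 0 /\
    exists P : {poly C}, (map_poly iota c)%:F * A ij.1 ij.2 = P%:F.
  case=> i j; have [p [d [d0 e]]] := prA i j.
  have [|c c0 cP] := @clear_denominator F C iota p d d0.
    by move=> z /rA/(_ i j); rewrite e.
  by exists c; rewrite e.
exists (\prod_ij c ij); first by apply/prodf_neq0 => ij _; case: (cP ij).
have /fin_all_exists[P PE] : forall ij : 'I_a * 'I_b, exists P : {poly C},
    (map_poly iota (\prod_ij c ij))%:F * A ij.1 ij.2 = P%:F.
  move=> ij; have [_ [P e]] := cP ij.
  exists (map_poly iota (\prod_(kl | kl != ij) c kl) * P).
  by rewrite (bigD1 ij) //= mulrC !rmorphM /= [RHS]mulrC -e; ring.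
by exists (\matrix_(i, j) P (i, j)); apply/matrixP=> i j; rewrite !mxE -PE.
Qed.

Lemma map_tofrac_inj a b : injective (@map_mx {poly C} (Ct C) (@tofrac _) a b).
Proof.
move=> A B /matrixP e; apply/matrixP=> i j; have /eqP := e i j.
by rewrite !mxE tofrac_eq => /eqP.
Qed.

Lemma clear_twistm1_mx (c : {poly F}) a b (A B : 'M[Ct C]_(a, b)) P : c != 0 ->
  twistm1_mx F A B -> (map_poly iota c)%:F *: A = map_mx (@tofrac _) P ->
  (map_poly iota c)%:F *: B = map_mx (@tofrac _) (map_mx qrtp P).
Proof.
move=> c0 AB /matrixP e; apply/matrixP=> i j; have := e i j; rewrite !mxE => eij.
have c0' : map_poly iota c != 0 by rewrite map_poly_eq0.
have c0F : (map_poly iota c)%:F != 0 by rewrite tofrac_eq0.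
have := @twistm1_frac F C iota _ _ (P i j) _ (AB i j) c0'.
rewrite map_poly_qrt_iota -eij [_ * A i j]mulrC mulfK // => -> //.
by rewrite mulrC divfK.
Qed.

Lemma clear_denominators_system n (alpha : 'I_n -> C) (E : 'I_n -> 'M[Ct C]_m.+1)
    (g gm1 : 'rV[Ct C]_m.+1) :
  (forall i, exists Em1, twistm1_mx F (E i) Em1 /\ Phi *m E i = Em1 *m Phi) ->
  twistm1_mx F g gm1 -> gm1 *m Phi + \sum_i h_tr m.+1 (alpha i) *m E i = g ->
  exists (P : 'I_n -> 'M[{poly C}]_m.+1) (G : 'rV[{poly C}]_m.+1),
    [/\ forall i, P i = 0 -> E i = 0,
        forall i, Phi_poly *m P i = map_mx qrtp (P i) *m Phi_poly
      & map_mx qrtp G *m Phi_poly + \sum_i (alpha i)%:P *: row ord0 (P i) = G].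
Proof.
move=> /fin_all_exists[Em1 EP] gg ge.
have EE i : twistm1_mx F (E i) (Em1 i) by case: (EP i).
have PhiE i : Phi *m E i = Em1 i *m Phi by case: (EP i).
have rE i z : ~ periodic iota z -> regular_mx z (E i).
  exact: endomorphism_regular (EE i) (PhiE i).
have rv z : ~ periodic iota z -> regular_mx z (\sum_i h_tr m.+1 (alpha i) *m E i).
  move=> zp k l; rewrite summxE; apply: regular_sum => i _; apply: regular_mulmx; last exact: rE.
  by move=> ? ?; rewrite mxE; case: ifP => _; rewrite -?tofrac0; apply: regular_poly.
have rg z : ~ periodic iota z -> regular_mx z g by exact: solution_regular gg ge rv.
have [c c0 [G GE]] := clear_denominators_mx (twistm1_presented gg) rg.
have /fin_all_exists[d dP] i : exists d : {poly F}, d != 0 /\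
    exists P : 'M[{poly C}]_m.+1, (map_poly iota d)%:F *: E i = map_mx (@tofrac _) P.
  have [d d0 [P PE]] := clear_denominators_mx (twistm1_presented (EE i)) (rE i).
  by exists d; split=> //; exists P.
(* One multiplier clears [g] and all the [E i] at once; both equations are linear over
   $\mathbb{F}_q[t]$ and survive the scaling. *)
pose a := c * \prod_i d i.
have a0 : a != 0.
  by rewrite mulf_neq0 //; apply/prodf_neq0 => i _; case: (dP i).
have /fin_all_exists[P PE] i : exists P : 'M[{poly C}]_m.+1,
    (map_poly iota a)%:F *: E i = map_mx (@tofrac _) P.
  have [_ [P e]] := dP i.
  exists (map_poly iota (c * \prod_(k | k != i) d k) *: P).
  rewrite map_mxZ -e scalerA -!rmorphM; congr (tofrac (map_poly iota _) *: _).
  by rewrite /a (bigD1 i) //=; ring.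
have {}GE : (map_poly iota a)%:F *: g = map_mx (@tofrac _) (map_poly iota (\prod_i d i) *: G).
  by rewrite map_mxZ -GE scalerA -!rmorphM mulrC.
have PE' i := clear_twistm1_mx a0 (EE i) (PE i).
have GE' := clear_twistm1_mx a0 gg GE.
exists P, (map_poly iota (\prod_i d i) *: G); split=> [i P0|i|].
- have /eqP := PE i; rewrite P0 map_mx0 scaler_eq0 tofrac_eq0 map_poly_eq0 (negPf a0).
  by move/eqP.
- apply: map_tofrac_inj.
  by rewrite !map_mxM map_Phi_poly -PE -PE' -scalemxAr PhiE -scalemxAl.
apply: map_tofrac_inj; rewrite map_mxD map_mxM map_Phi_poly -GE' -GE -[in RHS]ge.
rewrite scalerDr -scalemxAl; congr (_ + _); rewrite raddf_sum scaler_sumr; apply: eq_bigr => i _.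
rewrite /= map_mxZ map_row -PE; apply/rowP=> j.
(* Only the first coordinate of $\mathbf{h}_\alpha$ is nonzero, so its product with a matrix is
   alpha times the first row. *)
rewrite !mxE big_ord_recl !mxE /= big1 ?addr0; last first.
  by move=> k _; rewrite mxE /= mul0r.
by ring.
Qed.

End Denominators.

(** * The operator attached to an endomorphism of the t-motive *)

Section PolyEval.
Variables (C : comNzRingType) (f : {additive C -> C}).

(** Substitution of [f] for t on the left: powers of [f] act on the coefficients. Multiplying by t
    and applying [f] to the coefficients then have the same effect, so ['X * p - map_poly f p]
    evaluates to 0. *)
Definition op_eval (p : {poly C}) : C := \sum_(i < size p) iter i f p`_i.

Lemma iter_raddf_zmod i : zmod_morphism (iter i f).
Proof. by elim: i => [|i IH] x y //=; rewrite IH raddfB. Qed.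

Lemma iter_raddf0 i : iter i f 0 = 0.
Proof. by elim: i => //= i ->; rewrite raddf0. Qed.

Lemma op_eval_wide n (p : {poly C}) : (size p <= n)%N -> op_eval p = \sum_(i < n) iter i f p`_i.
Proof.
move=> pn; rewrite /op_eval (big_ord_widen n (fun i => iter i f p`_i)) //.
rewrite big_mkcond; apply: eq_bigr => i _; case: ltnP => // ip.
by rewrite nth_default // iter_raddf0.
Qed.

Lemma op_eval_is_zmod_morphism : zmod_morphism op_eval.
Proof.
move=> p q; pose n := maxn (size p) (size q).
rewrite (@op_eval_wide n p) ?leq_maxl // (@op_eval_wide n q) ?leq_maxr //.
rewrite (@op_eval_wide n); last by rewrite (leq_trans (size_polyD _ _)) // size_polyN.
by rewrite -sumrB; apply: eq_bigr => i _; rewrite coefB iter_raddf_zmod.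
Qed.

HB.instance Definition _ := GRing.isZmodMorphism.Build {poly C} C op_eval op_eval_is_zmod_morphism.

Lemma op_eval_mulX p : op_eval ('X * p) = f (op_eval p).
Proof.
rewrite (@op_eval_wide (size p).+1); last by rewrite (leq_trans (size_polyMleq _ _)) // size_polyX.
rewrite big_ord_recl coefXM add0r raddf_sum; apply: eq_bigr => i _.
by rewrite coefXM.
Qed.

Lemma op_eval_map p : op_eval (map_poly f p) = f (op_eval p).
Proof.
rewrite (@op_eval_wide (size p)) ?size_poly // raddf_sum; apply: eq_bigr => i _.
by rewrite coef_map -iterSr.
Qed.

End PolyEval.

(** * The action of $\rho_t$ as an additive map and as a polynomial *)

Section DrinfeldOperator.
Variables (F : finFieldType) (C : closedFieldType) (iota : {rmorphism F -> C}).
Variables (theta : C) (r : nat) (kappa : nat -> C).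

Definition drinfeld (_ : {rmorphism F -> C}) (x : C) : C :=
  \sum_(j < r.+1) rhoc theta r kappa j * x ^+ (qq F ^ j).

Lemma drinfeld_is_zmod_morphism : zmod_morphism (drinfeld iota).
Proof.
move=> x y; apply/eqP; rewrite eq_sym subr_eq; apply/eqP.
rewrite /drinfeld -big_split; apply: eq_bigr => j _ /=.
by rewrite -mulrDr -exprD_qqX // subrK.
Qed.

HB.instance Definition _ :=
  GRing.isZmodMorphism.Build C C (drinfeld iota) drinfeld_is_zmod_morphism.

Definition drinfeld_poly : {poly C} := \sum_(j < r.+1) rhoc theta r kappa j *: 'X^(qq F ^ j).

Lemma horner_drinfeld_poly x : drinfeld_poly.[x] = drinfeld iota x.
Proof. by rewrite /drinfeld_poly horner_sum; apply: eq_bigr => j _; rewrite !hornerE. Qed.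

Lemma size_drinfeld_poly : (0 < r)%N -> size drinfeld_poly = (qq F ^ r).+1.
Proof.
move=> r0; rewrite /drinfeld_poly big_ord_recr /=.
rewrite {2}/rhoc (gtn_eqF r0) ltnn eqxx scale1r addrC size_polyDl ?size_polyXn //.
rewrite ltnS; apply: (leq_trans (size_sum _ _ _)); apply/bigmax_leqP => j _.
rewrite (leq_trans (size_scale_leq _ _)) // size_polyXn.
by rewrite ltn_exp2l ?qq_gt1 ?ltn_ord.
Qed.

(** Horner scheme for the polynomial $\sum_i \rho_t^i\circ f_i$. *)
Fixpoint op_poly n (f : nat -> {poly C}) : {poly C} :=
  if n is n'.+1 then f 0%N + (drinfeld_poly \Po op_poly n' (fun i => f i.+1)) else 0.

Lemma horner_op_poly n f x :
  (op_poly n f).[x] = \sum_(i < n) iter i (drinfeld iota) (f i).[x].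
Proof.
elim: n f => [|n IH] f /=; first by rewrite horner0 big_ord0.
rewrite big_ord_recl hornerD horner_comp horner_drinfeld_poly IH raddf_sum.
by congr (_ + _); apply: eq_bigr => i _; rewrite /= /bump.
Qed.

(** Uniqueness of expansions in powers of $\rho_t$. The tail [g] vanishes at 0, so if nonzero it is
    nonconstant and $\rho_t\circ g$ has degree at least $q^r$, too large to cancel [f 0]. *)
Lemma op_poly_eq0 n (f : nat -> {poly C}) : (0 < r)%N ->
  (forall i, (size (f i) <= qq F ^ r)%N) -> (forall i, (f i).[0] = 0) ->
  op_poly n f = 0 -> forall i, (i < n)%N -> f i = 0.
Proof.
move=> r0; elim: n f => // n IH f szf f0 /=.
set g := op_poly n _ => e.
have g0 : g.[0] = 0.
  by rewrite horner_op_poly big1 // => i _; rewrite f0 iter_raddf0.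
have gz : g = 0.
  apply/eqP/contraT => gn0.
  have szg : (1 < size g)%N.
    rewrite ltnNge; apply: contraNN gn0 => /size1_polyC gE.
    by move: g0; rewrite gE hornerC => ->.
  have := size_comp_poly drinfeld_poly g; rewrite size_drinfeld_poly //= => sz.
  have : (size (drinfeld_poly \Po g) <= qq F ^ r)%N.
    by rewrite -(addr0_eq e) size_polyN szf.
  rewrite leqNgt; case: (size _) sz => [|s] /= sz.
    move: (expn_gt0 (qq F) r); rewrite qq_gt0 /= => q0.
    by move: szg; rewrite -subn_gt0 subn1 -(ltn_pmul2l q0) muln0 -sz.
  by rewrite sz ltnS -[X in (X <= _)%N]muln1 leq_mul2l -subn1 subn_gt0 szg orbT.
move: e; rewrite gz comp_poly0r.
have -> : drinfeld_poly`_0 = 0 by rewrite -horner_coef0 horner_drinfeld_poly raddf0.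
rewrite addr0 => e [|i] // ilt.
exact: (IH (fun i => f i.+1) _ _ gz).
Qed.

End DrinfeldOperator.

(** * Operators attached to rows, and their invariance under sigma *)

Section EndomorphismOperator.
Variables (F : finFieldType) (C : closedFieldType) (iota : {rmorphism F -> C}).
Variables (theta : C) (kappa : nat -> C) (m : nat).

Local Notation frobp := (map_poly (frob iota)).
Local Notation qrtp := (map_poly (qrt iota)).
Local Notation rho := (drinfeld theta m.+1 kappa iota).
Local Notation Phi := (Phi_poly iota theta kappa m).

Lemma iter_frobpB j p1 p2 : iter j frobp (p1 - p2) = iter j frobp p1 - iter j frobp p2.
Proof. by elim: j => //= j ->; rewrite rmorphB. Qed.

Lemma iter_frobpM j p1 p2 : iter j frobp (p1 * p2) = iter j frobp p1 * iter j frobp p2.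
Proof. by elim: j => //= j ->; rewrite rmorphM. Qed.

Lemma iter_frobpX j : iter j frobp 'X = 'X.
Proof. by elim: j => //= j ->; rewrite map_polyX. Qed.

Lemma iter_frobpC j c : iter j frobp c%:P = (iter j (frob iota) c)%:P.
Proof. by elim: j => //= j ->; rewrite map_polyC. Qed.

Lemma coef_iter_frobp j p i : (iter j frobp p)`_i = p`_i ^+ (qq F ^ j).
Proof. by rewrite -(iter_frob iota); elim: j => //= j <-; rewrite coef_map. Qed.

Definition twist_sum (w : 'rV[{poly C}]_m.+1) : {poly C} := \sum_(j < m.+1) iter j frobp (w 0 j).

(* A row [w] stands for the operator \sum_j w_j^(j) tau^j; [row_eval (c%:P *: w)] is
   its value at [c] once t is replaced by rho_t. *)
Definition row_eval w := op_eval rho (twist_sum w).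

Lemma row_eval_is_zmod_morphism : zmod_morphism row_eval.
Proof.
move=> w1 w2; rewrite /row_eval -raddfB; congr (op_eval _ _).
by rewrite /twist_sum -sumrB; apply: eq_bigr => j _; rewrite !mxE iter_frobpB.
Qed.

HB.instance Definition _ :=
  GRing.isZmodMorphism.Build 'rV[{poly C}]_m.+1 C row_eval row_eval_is_zmod_morphism.

Definition sigma_row (w : 'rV[{poly C}]_m.+1) := map_mx qrtp w *m Phi.

Lemma map_poly_drinfeld h :
  map_poly rho h = \sum_(j < m.+2) rhoc theta m.+1 kappa j *: iter j frobp h.
Proof.
apply/polyP => i; rewrite coef_map coef_sum; apply: eq_bigr => j _.
by rewrite coefZ coef_iter_frobp.
Qed.

Lemma rhoc_kappa (i : 'I_m) : rhoc theta m.+1 kappa i.+1 = kappa i.+1.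
Proof. by rewrite /rhoc /= ltnS ltn_ord. Qed.

Lemma rhoc_lead : rhoc theta m.+1 kappa m.+1 = 1.
Proof. by rewrite /rhoc /= ltnn eqxx. Qed.

(** $\Phi_\rho$ moves each entry one place to the right, where the extra twist undoes the inverse
    twist. Only the last entry does not telescope, and what it leaves is $th-\rho_t(h)$, which left
    substitution of $\rho_t$ for t kills. *)
Lemma twist_sum_sigma (w : 'rV[{poly C}]_m.+1) (h := qrtp (w 0 ord_max)) :
  twist_sum (sigma_row w) = twist_sum w + ('X * h - map_poly rho h).
Proof.
have sE (j : 'I_m) : iter (lift ord0 j) frobp (sigma_row w 0 (lift ord0 j)) =
    iter j frobp (w 0 (widen_ord (leqnSn m) j)) - kappa j.+1 *: iter j.+1 frobp h.
  rewrite lift0 /sigma_row shift_mx_col !mxE -/h.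
  rewrite iter_frobpB iter_frobpM iter_frobpC iter_qrtK mulrC mul_polyC.
  rewrite [iter _ _ (qrtp _)]iterSr map_poly_qrtK; congr (iter _ _ (w _ _) - _).
  by apply: val_inj; rewrite /= /bump leqNgt ltn_ord.
rewrite /twist_sum big_ord_recl [X in _ = X + _]big_ord_recr (eq_bigr _ (fun j _ => sE j)).
rewrite /sigma_row shift_mx_col0 mxE -/h sumrB map_poly_drinfeld big_ord_recl big_ord_recr.
rewrite [X in _ = _ + (_ - (_ + (X + _)))](eq_bigr (fun j : 'I_m =>
  kappa j.+1 *: iter j.+1 frobp h)); last by move=> j _; rewrite lift0 -rhoc_kappa.
rewrite lift0 rhoc_lead scale1r -[w 0 ord_max](map_poly_qrtK iota) -/h -iterSr.
rewrite [rhoc _ _ _ _]/rhoc /= -mul_polyC; ring.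
Qed.

Lemma row_eval_sigma w : row_eval (sigma_row w) = row_eval w.
Proof.
by rewrite /row_eval twist_sum_sigma raddfD raddfB /= op_eval_mulX op_eval_map subrr addr0.
Qed.

Lemma row_eval_iter_sigma k w : row_eval (iter k sigma_row w) = row_eval w.
Proof. by elim: k => //= k <-; rewrite row_eval_sigma. Qed.

Lemma sigma_rowZ p w : sigma_row (p *: w) = qrtp p *: sigma_row w.
Proof. by rewrite /sigma_row map_mxZ scalemxAl. Qed.

Lemma iter_sigma_rowZ k c w :
  iter k sigma_row (c%:P *: w) = (iter k (qrt iota) c)%:P *: iter k sigma_row w.
Proof. by elim: k => //= k ->; rewrite sigma_rowZ map_polyC. Qed.

Lemma row_evalX w : row_eval ('X *: w) = rho (row_eval w).
Proof.
rewrite -op_eval_mulX /row_eval; congr (op_eval _ _).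
by rewrite /twist_sum mulr_sumr; apply: eq_bigr => j _; rewrite mxE iter_frobpM iter_frobpX.
Qed.

Section Commuting.
Variable P : 'M[{poly C}]_m.+1.
Hypothesis PhiP : Phi *m P = map_mx qrtp P *m Phi.
Local Notation w := (row ord0 P).

Lemma sigma_row_row i : sigma_row (row i P) = row i (Phi *m P).
Proof. by rewrite PhiP row_mul /sigma_row map_row. Qed.

(** In the commutation relation, row i of $\Phi_\rho P$ is row i+1 of [P], and row i of the other
    side is sigma of row i. Hence the first row determines [P]. *)
Lemma row_iter_sigma i : row i P = iter i sigma_row w.
Proof.
case: i => k; elim: k => [|k IH] hk /=.
  by congr (row _ P); apply: val_inj.
have km : (k < m)%N by [].
rewrite -(IH (ltnW hk)) sigma_row_row.
have -> : Ordinal (ltnW hk) = lift ord_max (Ordinal km).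
  by apply: val_inj; rewrite /= /bump leqNgt km.
have -> : Ordinal hk = lift ord0 (Ordinal km) by apply: val_inj.
by apply/rowP => j; rewrite mxE [RHS]mxE [RHS]shift_mx_row.
Qed.

(** The last row of the commutation relation: the adjoint of $\rho_t$, with coefficients
    $\kappa_j^{(-j)}$ and powers of sigma, acts on the first row as multiplication by t. *)
Lemma sigma_relation :
  \sum_(j < m.+2) (iter j (qrt iota) (rhoc theta m.+1 kappa j))%:P *: iter j sigma_row w
    = 'X *: w.
Proof.
have qrt1 k : iter k (qrt iota) 1 = 1.
  by elim: k => [|k IH] //; rewrite iterS IH; apply: rmorph1.
have sm : iter m.+1 sigma_row w = ('X - theta%:P) *: w -
    \sum_(i < m) (iter i.+1 (qrt iota) (kappa i.+1))%:P *: iter i.+1 sigma_row w.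
  rewrite iterS -(row_iter_sigma ord_max) sigma_row_row.
  apply/rowP=> j; rewrite mxE shift_mx_row_max !mxE summxE; congr (_ - _).
  by apply: eq_bigr => i _; rewrite mxE -(row_iter_sigma (lift ord0 i)) mxE.
rewrite big_ord_recl big_ord_recr lift0 rhoc_lead qrt1 scale1r sm.
rewrite (eq_bigr (fun i : 'I_m =>
   (iter i.+1 (qrt iota) (kappa i.+1))%:P *: iter i.+1 sigma_row w)); last first.
  by move=> i _; rewrite lift0 -rhoc_kappa.
rewrite [X in _ + X]addrC subrK [rhoc _ _ _ _]/rhoc /=.
by rewrite -scalerDl addrC subrK.
Qed.

(** Outer $\rho_t$ is multiplication by t, which [sigma_relation] rewrites in powers of sigma;
    sigma-invariance of [row_eval] then matches it with the inner $\rho_t$ term by term. *)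
Lemma row_eval_rho x : row_eval ((rho x)%:P *: w) = rho (row_eval (x%:P *: w)).
Proof.
rewrite -row_evalX scalerA mulrC -scalerA -sigma_relation scaler_sumr.
rewrite {1}/drinfeld raddf_sum scaler_suml !raddf_sum; apply: eq_bigr => j _ /=.
rewrite -[LHS](row_eval_iter_sigma j) iter_sigma_rowZ scalerA -polyCM.
congr (row_eval (_%:P *: _)); apply: (can_inj (iter_frobK iota j)).
rewrite iter_qrtK !iter_frob exprMn mulrC; congr (_ * _).
by rewrite -(iter_frob iota) iter_qrtK.
Qed.

End Commuting.

Lemma row_eval_poly w : exists p : {poly C},
  [/\ forall x, p.[x] = row_eval (x%:P *: w), p.[0] = 0 & p = 0 -> w = 0].
Proof.
(* [f i] is the coefficient of $t^i$ in the operator applied to x. Its degree in x is below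
   $q^{m+1}$, as [op_poly_eq0] requires. *)
pose f i : {poly C} := \sum_(j < m.+1) (w 0 j)`_i ^+ (qq F ^ j) *: 'X^(qq F ^ j).
pose n := \max_(j < m.+1) size (w 0%R j).
have fE i x : (f i).[x] = (twist_sum (x%:P *: w))`_i.
  rewrite horner_sum coef_sum; apply: eq_bigr => j _.
  by rewrite !hornerE mxE coef_iter_frobp coefCM exprMn mulrC.
have fx i : (f i).[0] = 0.
  rewrite fE polyC0 scale0r /twist_sum big1 ?coef0 // => j _.
  by rewrite mxE; elim: (val j) => //= k ->; rewrite rmorph0.
have szf i : (size (f i) <= qq F ^ m.+1)%N.
  apply: (leq_trans (size_sum _ _ _)); apply/bigmax_leqP => j _.
  rewrite (leq_trans (size_scale_leq _ _)) // size_polyXn.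
  by rewrite ltn_exp2l ?qq_gt1 ?ltn_ord.
have w_big i j : (n <= i)%N -> (w 0 j)`_i = 0.
  by move=> ni; rewrite nth_default // (leq_trans _ ni) // (leq_bigmax j).
exists (op_poly F theta m.+1 kappa n f); split.
- move=> x; rewrite (horner_op_poly iota) /row_eval (@op_eval_wide _ _ n).
    by apply: eq_bigr => i _; rewrite fE.
  apply/leq_sizeP => i ni; rewrite coef_sum big1 // => j _.
  by rewrite coef_iter_frobp mxE coefCM w_big // mulr0 expr0n expn_eq0 (gtn_eqF (qq_gt0 F)).
- by rewrite (horner_op_poly iota) big1 // => i _; rewrite fx iter_raddf0.
move=> /(op_poly_eq0 iota (ltn0Sn m) szf fx) f0.
apply/rowP => j; rewrite mxE; apply/polyP=> i; rewrite coef0.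
have [|ni] := ltnP i n; last exact: w_big.
move=> /f0/(congr1 (fun p : {poly C} => p`_(qq F ^ j))); rewrite coef0 coef_sum.
(* The exponents $q^j$ are distinct, so each coefficient of [f i] isolates one entry of [w]. *)
rewrite (bigD1 j) //= big1 ?addr0 => [|k kj].
  by rewrite coefZ coefXn eqxx mulr1 => /eqP; rewrite expf_eq0 => /andP[_ /eqP].
by rewrite coefZ coefXn eqn_exp2l ?qq_gt1 // eq_sym val_eqE (negPf kj) mulr0.
Qed.

Lemma endomorphism_operator (P : 'M[{poly C}]_m.+1) :
  Phi *m P = map_mx qrtp P *m Phi -> exists p : {poly C},
  [/\ forall x, p.[x] = row_eval (x%:P *: row ord0 P), p.[0] = 0, p = 0 -> P = 0
    & forall x, p.[rho x] = rho p.[x]].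
Proof.
move=> PhiP; have [p [pE p0 pn0]] := row_eval_poly (row ord0 P).
exists p; split=> // [/pn0 w0|x]; last by rewrite !pE row_eval_rho.
apply/row_matrixP => i; rewrite (row_iter_sigma PhiP) w0 row0.
by elim: (val i) => //= k ->; rewrite /sigma_row map_mx0 mul0mx.
Qed.

(** The first summand is sigma of [G], whose value equals that of [G]; the two cancel. *)
Lemma row_eval_solution n (alpha : 'I_n -> C) (P : 'I_n -> 'M[{poly C}]_m.+1) G :
  map_mx qrtp G *m Phi + \sum_i (alpha i)%:P *: row ord0 (P i) = G ->
  \sum_i row_eval ((alpha i)%:P *: row ord0 (P i)) = 0.
Proof.
move=> /(congr1 row_eval); rewrite raddfD /= -/(sigma_row G) row_eval_sigma raddf_sum.
by rewrite -[RHS]addr0 => /addrI.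
Qed.

End EndomorphismOperator.

(** * Additive functions near the origin and the exponential *)

(** Bernoulli's inequality and the archimedean property. *)
Lemma exists_lt_expr (R : realType) (T M : R) : 1 < T -> exists k, M < T ^+ k.
Proof.
move=> T1; have bern k : 1 + k%:R * (T - 1) <= T ^+ k.
  elim: k => [|k IH]; first by rewrite mul0r addr0.
  have k0 : 0 <= k%:R :> R by [].
  have T0 : 0 <= T by lra.
  rewrite exprS -natr1 (le_trans _ (ler_wpM2l T0 IH)) //.
  by have := mulr_ge0 k0 (sqr_ge0 (T - 1)); nra.
have T0 : 0 < T - 1 by rewrite subr_gt0.
exists (Num.bound (`|M| / (T - 1))); apply: lt_le_trans (bern _).
have := @archi_boundP R (`|M| / (T - 1)); rewrite divr_ge0 ?normr_ge0 ?(ltW T0) // => /(_ isT).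
rewrite ltr_pdivrMr // => h; have := ler_norm M; lra.
Qed.

Section Ultrametric.
Variables (C : closedFieldType) (R : realType) (abs : C -> R).
Hypotheses (abs_ge0 : forall x, 0 <= abs x) (abs_eq0 : forall x, abs x = 0 <-> x = 0).
Hypothesis absM : forall x y, abs (x * y) = abs x * abs y.
Hypothesis abs_ultra : forall x y, abs (x + y) <= Num.max (abs x) (abs y).

Lemma abs0 : abs 0 = 0. Proof. exact/abs_eq0. Qed.

Lemma abs_gt0 x : x != 0 -> 0 < abs x.
Proof. by move=> x0; rewrite lt0r abs_ge0 andbT; apply: contraNneq x0 => /abs_eq0 ->. Qed.

Lemma abs1 : abs 1 = 1.
Proof.
have a0 := abs_gt0 (oner_neq0 C); apply: (mulfI (lt0r_neq0 a0)).
by rewrite -absM !mulr1.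
Qed.

Lemma absX x n : abs (x ^+ n) = abs x ^+ n.
Proof. by elim: n => [|n IH]; rewrite ?expr0 ?abs1 // !exprS absM IH. Qed.

Lemma absV x : abs x^-1 = (abs x)^-1.
Proof.
have [->|x0] := eqVneq x 0; first by rewrite invr0 abs0 invr0.
by apply: (mulfI (lt0r_neq0 (abs_gt0 x0))); rewrite -absM !divff ?abs1 ?lt0r_neq0 ?abs_gt0.
Qed.

Lemma absN x : abs (- x) = abs x.
Proof.
rewrite -mulN1r absM; have -> : abs (-1) = 1; last by rewrite mul1r.
by apply/eqP; rewrite -sqrp_eq1 ?abs_ge0 // -absX sqrrN expr1n abs1.
Qed.

Lemma absB_ultra x y : abs (x - y) <= Num.max (abs x) (abs y).
Proof. by rewrite (le_trans (abs_ultra _ _)) // absN. Qed.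

Lemma absD_le x y : abs (x + y) <= abs x + abs y.
Proof.
by rewrite (le_trans (abs_ultra _ _)) // ge_max lerDl lerDr !abs_ge0.
Qed.

Lemma abs_sum_le n (f : 'I_n -> C) B :
  0 <= B -> (forall i, abs (f i) <= B) -> abs (\sum_i f i) <= B.
Proof.
move=> B0 fB; elim/big_ind: _ => // [|x y xB yB]; first by rewrite abs0.
by rewrite (le_trans (abs_ultra _ _)) // ge_max xB.
Qed.

Lemma abs_lim_unique u l1 l2 : abs_lim abs u l1 -> abs_lim abs u l2 -> l1 = l2.
Proof.
move=> u1 u2; apply/eqP/contraT; rewrite -subr_eq0 => /abs_gt0 d0.
have [N1 h1] := u1 _ d0; have [N2 h2] := u2 _ d0.
have := h1 _ (leq_maxl N1 N2); have := h2 _ (leq_maxr N1 N2).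
set v := u _ => a2 a1; have : abs (l1 - l2) < abs (l1 - l2); last by rewrite ltxx.
have {1}-> : l1 - l2 = (v - l2) - (v - l1) by ring.
by rewrite (le_lt_trans (absB_ultra _ _)) // gt_max a2 a1.
Qed.

Lemma abs_limD u v l l' : abs_lim abs u l -> abs_lim abs v l' ->
  abs_lim abs (fun n => u n + v n) (l + l').
Proof.
move=> ul vl e e0; have [N h] := ul e e0; have [N' h'] := vl e e0.
exists (maxn N N') => n; rewrite geq_max => /andP[/h a /h' b].
have -> : u n + v n - (l + l') = (u n - l) + (v n - l') by ring.
by rewrite (le_lt_trans (abs_ultra _ _)) // gt_max a.
Qed.

Lemma abs_lim_bound u l c B N : abs_lim abs u l ->
  (forall n, (N <= n)%N -> abs (u n - c) <= B) -> abs (l - c) <= B.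
Proof.
move=> ul uB; rewrite leNgt; apply/negP => lt.
have [|N' h] := ul (abs (l - c)).
  by rewrite (le_lt_trans _ lt) // (le_trans (abs_ge0 _) (uB N _)).
have a := h _ (leq_maxr N N'); have b := uB _ (leq_maxl N N').
suff : abs (l - c) < abs (l - c) by rewrite ltxx.
have {1}-> : l - c = (u (maxn N N') - c) - (u (maxn N N') - l) by ring.
by rewrite (le_lt_trans (absB_ultra _ _)) // gt_max a (le_lt_trans b).
Qed.

(** A quantitative form of $f(z)=bz+O(z^2)$ at 0. *)
Definition tangent (f : C -> C) (b : C) : Prop :=
  exists d B, [/\ 0 < d, 0 <= B & forall z, abs z <= d -> abs (f z - b * z) <= B * abs z ^+ 2].

Lemma tangent_linear b : tangent (fun z => b * z) b.
Proof. by exists 1, 0; split=> // z _; rewrite subrr abs0 mul0r. Qed.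

Lemma tangentB f g a b : tangent f a -> tangent g b -> tangent (fun z => f z - g z) (a - b).
Proof.
move=> [d [B [d0 B0 fB]]] [d' [B' [d'0 B'0 gB]]].
exists (Num.min d d'), (B + B'); split=> [||z]; first by rewrite lt_min d0.
  exact: addr_ge0.
rewrite le_min => /andP[/fB zf /gB zg].
have -> : f z - g z - (a - b) * z = (f z - a * z) - (g z - b * z) by ring.
rewrite (le_trans (absD_le _ _)) // absN mulrDl; exact: lerD.
Qed.

Lemma tangent_bound f a : tangent f a -> exists d B, [/\ 0 < d, 0 <= B
  & forall z, abs z <= d -> abs (f z) <= B * abs z].
Proof.
move=> [d [B [d0 B0 fB]]]; exists (Num.min d 1), (B + abs a); split=> [||z].
- by rewrite lt_min d0 ltr01.
- by rewrite addr_ge0 // abs_ge0.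
rewrite le_min => /andP[/fB zf z1].
rewrite -(subrK (a * z) (f z)) (le_trans (absD_le _ _)) // absM mulrDl lerD2r.
rewrite (le_trans zf) // ler_wpM2l // expr2 -[leRHS]mulr1.
by rewrite ler_wpM2l // abs_ge0.
Qed.

Lemma tangent_comp f g a b : tangent f a -> tangent g b -> tangent (fun z => f (g z)) (a * b).
Proof.
move=> [d [B [d0 B0 fB]]] tg; have [d1 [B1 [d10 B10 gB1]]] := tangent_bound tg.
have [d' [B' [d'0 B'0 gB]]] := tg.
have B11 : 0 < B1 + 1 by lra.
(* The first radius keeps [g z] in the ball where [f] is controlled; the 1 keeps its denominator
   positive. The two terms of the bound are the errors from [f] and from [g]. *)
exists (Num.min (d / (B1 + 1)) (Num.min d1 d')), (B * B1 ^+ 2 + abs a * B').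
split=> [||z].
- by rewrite !lt_min d10 d'0 divr_gt0.
- by rewrite addr_ge0 ?mulr_ge0 ?exprn_ge0 ?abs_ge0.
rewrite !le_min => /and3P[zd /gB1 gz1 /gB gz].
have a0 := abs_ge0 z.
have gd : abs (g z) <= d.
  rewrite ler_pdivlMr // in zd; rewrite (le_trans gz1) // (le_trans _ zd) //; nra.
have -> : f (g z) - a * b * z = (f (g z) - a * g z) + a * (g z - b * z) by ring.
rewrite (le_trans (absD_le _ _)) // absM mulrDl lerD //.
  rewrite (le_trans (fB _ gd)) // -mulrA ler_wpM2l // -exprMn.
  by rewrite lerXn2r ?nnegrE ?abs_ge0 ?mulr_ge0.
by rewrite -mulrA ler_wpM2l ?abs_ge0.
Qed.

Lemma tangent_poly (p : {poly C}) : p.[0] = 0 -> exists b, tangent (horner p) b.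
Proof.
have bounded (g : {poly C}) : exists2 B, 0 <= B & forall z, abs z <= 1 -> abs g.[z] <= B.
  elim/poly_ind: g => [|g c [B B0 gB]].
    by exists 0 => // z _; rewrite horner0 abs0.
  exists (B + abs c); first by rewrite addr_ge0 ?abs_ge0.
  move=> z z1; rewrite !hornerE (le_trans (absD_le _ _)) // lerD2r absM.
  rewrite -[leRHS]mulr1; apply: ler_pM => //; exact: gB.
elim/poly_ind: p => [|p c _ p0].
  by exists 0, 1, 0; split=> // z; rewrite horner0 mul0r subrr abs0 mul0r.
have c0 : c = 0 by move: p0; rewrite !hornerE.
(* A second coefficient is split off: [b] is the linear coefficient. *)
elim/poly_ind: p p0 => [|p b _ _].
  by exists 0, 1, 0; split=> // z; rewrite c0 mul0r addr0 horner0 mul0r subrr abs0 mul0r.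
have [B B0 pB] := bounded p; exists b, 1, B; split=> // z z1.
rewrite c0 addr0 hornerMX hornerD hornerMX hornerC.
have -> : (p.[z] * z + b) * z - b * z = p.[z] * z ^+ 2 by ring.
rewrite absM absX; apply: ler_wpM2r; last exact: pB.
by rewrite exprn_ge0 ?abs_ge0.
Qed.

(* [f z = g^k (f (z / theta^k))]; [f] shrinks its argument quadratically near 0
   while [g] expands by at most [abs theta], so the right-hand side tends to 0. *)
Lemma tangent0_functional_eq0 (theta : C) (f g : C -> C) :
  1 < abs theta -> tangent f 0 -> tangent g theta ->
  (forall z, f (theta * z) = g (f z)) -> forall z, f z = 0.
Proof.
set T := abs theta => T1 [d [B [d0 B0 fB]]] [dg [Bg [dg0 Bg0 gB]]] fg z.
have T0 : 0 < T by lra.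
have th0 : theta != 0 by apply: contraTneq T0 => e; rewrite /T e abs0 ltxx.
(* Within this radius the quadratic error of [g] is at most [T * abs y], so the ultrametric
   inequality bounds [abs (g y)] by [T * abs y] with no loss. *)
pose e1 := Num.min dg (T / (Bg + 1)).
have e10 : 0 < e1 by rewrite lt_min dg0 divr_gt0 //; lra.
have gT y : abs y <= e1 -> abs (g y) <= T * abs y.
  rewrite le_min => /andP[/gB gy]; rewrite ler_pdivlMr; last by lra.
  move=> yT; rewrite -(subrK (theta * y) (g y)) (le_trans (abs_ultra _ _)) // ge_max absM lexx andbT.
  rewrite (le_trans gy) // expr2 mulrA ler_wpM2r ?abs_ge0 //; have := abs_ge0 y; nra.
have iter_g k y : T ^+ k * abs y <= e1 -> abs (iter k g y) <= T ^+ k * abs y.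
  elim: k y => [|k IH] y; first by rewrite expr0 mul1r.
  move=> yk; have Tk1 : 1 <= T ^+ k.+1 by rewrite exprn_ege1 // ltW.
  have gy : abs (g y) <= T * abs y.
    by apply: gT; rewrite (le_trans _ yk) // ler_peMl ?abs_ge0.
  have gy' : T ^+ k * abs (g y) <= T ^+ k.+1 * abs y.
    by rewrite exprSr -mulrA ler_wpM2l // exprn_ge0 // ltW.
  by rewrite iterSr (le_trans (IH _ (le_trans gy' yk))).
have f_iter k : f z = iter k g (f (z / theta ^+ k)).
  elim: k => [|k ->]; first by rewrite expr0 divr1.
  rewrite iterSr -fg; congr (iter k g (f _)).
  by rewrite exprS invfM; field; rewrite th0 expf_neq0.
apply/eqP/contraT => /abs_gt0 fz0.
pose e := Num.min e1 (abs (f z)); have e0 : 0 < e by rewrite lt_min e10.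
(* The first term brings [z / theta ^+ k] into the ball of radius [d]; the second makes $B|z|^2/T^k$
   smaller than [e]. *)
have [k hk] := exists_lt_expr (abs z / d + B * abs z ^+ 2 / e) T1.
have Tk0 : 0 < T ^+ k by rewrite exprn_gt0.
have s1 : 0 <= abs z / d by rewrite divr_ge0 ?abs_ge0 // ltW.
have s2 : 0 <= B * abs z ^+ 2 / e by rewrite divr_ge0 ?mulr_ge0 ?exprn_ge0 ?abs_ge0 // ltW.
have zd : abs (z / theta ^+ k) <= d.
  rewrite absM absV absX -/T ler_pdivrMr // mulrC -ler_pdivrMr //.
  by rewrite ltW // (le_lt_trans _ hk) // lerDl.
have small : T ^+ k * abs (f (z / theta ^+ k)) < e.
  have := fB _ zd; rewrite mul0r subr0 => h.
  rewrite (le_lt_trans (ler_wpM2l (ltW Tk0) h)) //.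
  have -> : T ^+ k * (B * abs (z / theta ^+ k) ^+ 2) = B * abs z ^+ 2 / T ^+ k.
    by rewrite absM absV absX -/T; field; rewrite lt0r_neq0.
  rewrite ltr_pdivrMr // [ltRHS]mulrC -ltr_pdivrMr //.
  by rewrite (le_lt_trans _ hk) // lerDr.
have : abs (f z) < abs (f z); last by rewrite ltxx.
rewrite {1}(f_iter k) (le_lt_trans (iter_g _ _ _)) //.
  by rewrite ltW // (lt_le_trans small) // ge_min lexx.
by rewrite (lt_le_trans small) // ge_min lexx orbT.
Qed.

End Ultrametric.

(** * The exponential near the origin and its commutation with operators *)

Section Exponential.
Variables (F : finFieldType) (C : closedFieldType) (R : realType).
Variables (iota : {rmorphism F -> C}) (theta : C) (abs : C -> R).
Hypothesis HC : is_Cinf iota theta abs.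
Variables (r : nat) (kappa ec : nat -> C).
Hypothesis Hexp : is_exp_coeffs F theta abs r kappa ec.

Local Notation rho := (drinfeld theta r kappa iota).
Local Notation exp_val := (exp_val F abs ec).

Let abs_ge0 x : 0 <= abs x. Proof. by case: HC => _ [/(_ x)[]]. Qed.
Let abs_eq0 x : abs x = 0 <-> x = 0. Proof. by case: HC => _ [/(_ x)[]]. Qed.
Let absM x y : abs (x * y) = abs x * abs y. Proof. by case: HC => _ [_ []]. Qed.
Let abs_ultra x y : abs (x + y) <= Num.max (abs x) (abs y).
Proof. by case: HC => _ [_ [_ []]]. Qed.
Let abs_theta : 1 < abs theta. Proof. by case: HC => _ [_ [_ [_ []]]]. Qed.

Lemma exp_val_unique z w1 w2 : exp_val z w1 -> exp_val z w2 -> w1 = w2.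
Proof. exact: abs_lim_unique. Qed.

Lemma exp_valD x y v w : exp_val x v -> exp_val y w -> exp_val (x + y) (v + w).
Proof.
move=> xv yw; rewrite /Defs.exp_val.
have -> : (fun n => \sum_(i < n) ec i * (x + y) ^+ (qq F ^ i)) =
    fun n => \sum_(i < n) ec i * x ^+ (qq F ^ i) + \sum_(i < n) ec i * y ^+ (qq F ^ i).
  apply/funext => n; rewrite -big_split; apply: eq_bigr => i _ /=.
  by rewrite -mulrDr exprD_qqX.
exact: abs_limD.
Qed.

Lemma exp_val0 : exp_val 0 0.
Proof.
move=> e e0; exists 0%N => n _; rewrite big1 ?subrr ?(abs0 abs_eq0) // => i _.
by rewrite expr0n expn_eq0 (gtn_eqF (qq_gt0 F)) mulr0.
Qed.

Lemma exp_val_theta z w : exp_val z w -> exp_val (theta * z) (rho w).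
Proof. by case: Hexp => _ _; apply. Qed.

(** The series converges at z = 1, so late coefficients, being differences of consecutive partial
    sums, are at most 1. *)
Lemma exp_coeff_bounded : exists2 B, 0 <= B & forall i, abs (ec i) <= B.
Proof.
case: Hexp => _ /(_ 1)[w] /(_ 1 ltr01)[N hN] _.
exists (1 + \sum_(i < N) abs (ec i)); first by rewrite addr_ge0 // sumr_ge0.
move=> i; have s0 (P : pred 'I_N) : 0 <= \sum_(i < N | P i) abs (ec i) by rewrite sumr_ge0.
have [iN|iN] := ltnP i N.
  by rewrite (bigD1 (Ordinal iN)) //= addrCA lerDl addr_ge0.
apply: (@le_trans _ _ 1); last by rewrite lerDl s0.
have a := hN _ iN; have b := hN _ (leqW iN); move: b; rewrite big_ord_recr /= expr1n mulr1 => b.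
have -> : ec i = (\sum_(j < i) ec j * 1 ^+ (qq F ^ j) + ec i - w)
     - (\sum_(j < i) ec j * 1 ^+ (qq F ^ j) - w) by ring.
rewrite (le_trans (absB_ultra abs_ge0 abs_eq0 absM abs_ultra _ _)) //.
by rewrite ge_max !ltW.
Qed.

Variable E : C -> C.
Hypothesis EP : forall z, exp_val z (E z).

(** Beyond the leading term z, every exponent $q^i$ is at least 2, so on the unit ball each term is
    at most $B|z|^2$, and so is the sum by the ultrametric inequality. *)
Lemma exp_tangent : tangent abs E 1.
Proof.
have [B B0 ecB] := exp_coeff_bounded; exists 1, B; split=> // z z1; rewrite mul1r.
apply: (abs_lim_bound abs_ge0 abs_eq0 absM abs_ultra (N := 1) (EP z)) => -[|n] // _.
rewrite big_ord_recl [(qq F ^ _)%N]expn0 expr1; case: Hexp => -> _ _; rewrite mul1r addrC addKr.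
apply: (abs_sum_le abs_eq0 abs_ultra); first by rewrite mulr_ge0 ?exprn_ge0.
move=> i; rewrite absM (absX abs_ge0 abs_eq0 absM).
apply: ler_pM => //; first by rewrite exprn_ge0.
rewrite ler_wiXn2l // lift0 expnS.
by rewrite (leq_trans (qq_gt1 F)) // leq_pmulr // expn_gt0 qq_gt0.
Qed.

Lemma drinfeld_tangent : tangent abs rho theta.
Proof.
exists 1, (\sum_(j < r) abs (rhoc theta r kappa j.+1)); split=> [||z z1] //.
  by rewrite sumr_ge0.
rewrite /drinfeld big_ord_recl [(qq F ^ _)%N]expn0 expr1
  (_ : rhoc theta r kappa ord0 = theta) // addrC addKr.
apply: (abs_sum_le abs_eq0 abs_ultra).
  by rewrite mulr_ge0 ?exprn_ge0 ?sumr_ge0.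
move=> i; rewrite absM (absX abs_ge0 abs_eq0 absM) lift0.
apply: ler_pM => //; first by rewrite exprn_ge0.
  by rewrite (bigD1 i) //= lerDl sumr_ge0.
rewrite ler_wiXn2l // expnS.
by rewrite (leq_trans (qq_gt1 F)) // leq_pmulr // expn_gt0 qq_gt0.
Qed.

Lemma expB x y : E (x - y) = E x - E y.
Proof.
apply/eqP; rewrite eq_sym subr_eq; apply/eqP; apply: (exp_val_unique (EP x)).
by rewrite -{1}(subrK y x); apply: exp_valD.
Qed.

Lemma exp0 : E 0 = 0. Proof. exact: exp_val_unique (EP 0) exp_val0. Qed.

Lemma exp_theta z : E (theta * z) = rho (E z).
Proof. exact: exp_val_unique (EP _) (exp_val_theta (EP z)). Qed.

(** A zero satisfies $|z|\le B|z|^2$, while the radius $1/(B+1)$ makes $B|z|<1$ for nonzero z. *)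
Lemma exp_injective_near0 : exists2 d, 0 < d &
  forall z, abs z <= d -> E z = 0 -> z = 0.
Proof.
have [d [B [d0 B0 EB]]] := exp_tangent.
exists (Num.min d (B + 1)^-1); first by rewrite lt_min d0 invr_gt0; lra.
move=> z; rewrite le_min => /andP[/EB zB]; rewrite -[_^-1]mul1r ler_pdivlMr; last lra.
move=> z1 Ez; apply/eqP/contraT => /(abs_gt0 abs_ge0 abs_eq0) z0.
move: zB; rewrite Ez mul1r sub0r (absN abs_ge0 abs_eq0 absM); nra.
Qed.

(** High negative powers of [theta] lie in the ball of injectivity and have distinct absolute
    values. A polynomial vanishing on the range of [E] is therefore 0. *)
Lemma exp_infinite_range : exists z_ : nat -> C, injective (E \o z_).
Proof.
have [d d0 Einj] := exp_injective_near0.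
have [N hN] := exists_lt_expr d^-1 abs_theta.
have aV := absV abs_ge0 abs_eq0 absM; have aX := absX abs_ge0 abs_eq0 absM.
have T0 : 0 < abs theta by apply: lt_trans abs_theta.
have zd k : abs (theta ^- (k + N)) <= d.
  rewrite aV aX -[leLHS]mul1r ler_pdivrMr ?exprn_gt0 // mulrC -ler_pdivrMr // mul1r.
  rewrite (le_trans (ltW hN)) // ler_weXn2l ?leq_addl // ltW //.
exists (fun k => theta ^- (k + N)) => k l /= e.
have e0 : theta ^- (k + N) - theta ^- (l + N) = 0.
  apply: Einj; last by rewrite expB e subrr.
  by rewrite (le_trans (absB_ultra abs_ge0 abs_eq0 absM abs_ultra _ _)) // ge_max !zd.
have /(congr1 abs) : theta ^- (k + N) = theta ^- (l + N) by apply/eqP; rewrite -subr_eq0 e0.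
rewrite !aV !aX => /invr_inj/(ieexprIn T0) => /(_ (negbT (gt_eqF abs_theta))).
exact: addIn.
Qed.

Lemma exp_operator (p : {poly C}) : p != 0 -> p.[0] = 0 ->
  (forall x, p.[rho x] = rho p.[x]) ->
  exists2 b, b != 0 & forall z, p.[E z] = E (b * z).
Proof.
move=> p0 pz pC; have [b tb] := tangent_poly abs_ge0 abs_eq0 absM abs_ultra pz.
have pE z : p.[E z] = E (b * z).
  apply/eqP; rewrite -subr_eq0; apply/eqP; move: z.
  apply: (tangent0_functional_eq0 abs_ge0 abs_eq0 absM abs_ultra abs_theta _ drinfeld_tangent).
    have := tangentB abs_ge0 abs_eq0 absM abs_ultra
      (tangent_comp abs_ge0 absM abs_ultra tb exp_tangent)
      (tangent_comp abs_ge0 absM abs_ultra exp_tangent (tangent_linear abs_eq0 b)).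
    by rewrite mulr1 mul1r subrr.
  by move=> z; rewrite exp_theta pC mulrCA exp_theta raddfB.
(* With [b = 0], [p] would vanish on the infinite range of [E]. *)
exists b => //; apply: contra_neq p0 => b0.
have [z_ z_inj] := exp_infinite_range.
apply: (poly_eq0_injective_roots z_inj) => i.
by rewrite rootE /= pE b0 mul0r exp0.
Qed.

End Exponential.

(** * The period lattice and dimension counting *)

Section PeriodLattice.
Variables (F : finFieldType) (C : closedFieldType) (R : realType).
Variables (iota : {rmorphism F -> C}) (theta : C) (abs : C -> R).
Hypothesis HC : is_Cinf iota theta abs.
Variables (r : nat) (kappa ec : nat -> C).
Hypothesis Hexp : is_exp_coeffs F theta abs r kappa ec.

Local Notation kev := (kev iota theta).
Local Notation in_k := (in_k iota theta).
Local Notation in_Lambda := (in_Lambda F abs ec).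
Local Notation in_End := (in_End F abs ec).
Local Notation in_Krho := (in_Krho F abs ec).

Lemma kevB a b : kev (a - b) = kev a - kev b.
Proof. by rewrite /Defs.kev rmorphB hornerD hornerN. Qed.

Lemma kevM a b : kev (a * b) = kev a * kev b.
Proof. by rewrite /Defs.kev rmorphM hornerM. Qed.

Lemma kev1 : kev 1 = 1. Proof. by rewrite /Defs.kev rmorph1 hornerC. Qed.

Lemma kev0 : kev 0 = 0. Proof. by rewrite /Defs.kev rmorph0 horner0. Qed.

Lemma in_k_kev a : in_k (kev a).
Proof. by exists a, 1; rewrite kev1 oner_neq0 divr1. Qed.

Lemma in_k0 : in_k 0. Proof. by rewrite -kev0; apply: in_k_kev. Qed.

Lemma in_k1 : in_k 1. Proof. by rewrite -kev1; apply: in_k_kev. Qed.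

Lemma in_kB x y : in_k x -> in_k y -> in_k (x - y).
Proof.
move=> [a [b [b0 ->]]] [c [d [d0 ->]]]; exists (a * d - c * b), (b * d).
by rewrite kevB !kevM mulf_neq0 // -mulNr addf_div // mulNr.
Qed.

Lemma in_kM x y : in_k x -> in_k y -> in_k (x * y).
Proof.
move=> [a [b [b0 ->]]] [c [d [d0 ->]]]; exists (a * c), (b * d).
by rewrite !kevM mulf_neq0 // mulf_div.
Qed.

Lemma in_kV x : in_k x -> in_k x^-1.
Proof.
move=> [a [b [b0 ->]]]; have [a0|a0] := eqVneq (kev a) 0.
  by rewrite a0 mul0r invr0; apply: in_k0.
by exists b, a; rewrite invf_div.
Qed.

Lemma theta_nonperiodic : ~ periodic iota theta.
Proof.
move=> /periodic_annihilator[a a0 /rootP ra].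
by case: HC => /(_ a a0); rewrite /Defs.kev ra eqxx.
Qed.

Lemma exp_valZ c z w : exp_val F abs ec z w -> exp_val F abs ec (iota c * z) (iota c * w).
Proof.
have [_ [absP [absM _]]] := HC.
have [c0 zw e e0|c0 zw e e0] := eqVneq (abs (iota c)) 0.
  have -> : iota c = 0 by apply/(absP _).2.
  by rewrite !mul0r; exact: (exp_val0 HC ec e0).
have ac0 : 0 < abs (iota c) by rewrite lt0r c0; case: (absP (iota c)).
have [N h] := zw _ (divr_gt0 e0 ac0).
exists N => n /h; rewrite ltr_pdivlMr // mulrC -absM mulrBr mulr_sumr.
congr (abs (_ - _) < e); apply: eq_bigr => i _; rewrite exprMn mulrCA; congr (_ * (_ * _)).
by rewrite -(iter_frob iota); elim: (val i) => //= j <-; rewrite /frob -rmorphXn /qq expf_card.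
Qed.

Lemma in_Lambda_theta z : in_Lambda z -> in_Lambda (theta * z).
Proof.
move=> lz; have := exp_val_theta iota Hexp lz.
by rewrite (raddf0 (drinfeld theta r kappa iota)).
Qed.

Lemma in_LambdaD x y : in_Lambda x -> in_Lambda y -> in_Lambda (x + y).
Proof. by move=> lx ly; rewrite /Defs.in_Lambda -[0]addr0; apply: (exp_valD HC). Qed.

Lemma in_Lambda_kev a z : in_Lambda z -> in_Lambda (kev a * z).
Proof.
move=> lz; elim/poly_ind: a => [|a c IH]; first by rewrite kev0 mul0r; apply: (exp_val0 HC).
rewrite /Defs.kev rmorphD rmorphM /= map_polyX map_polyC !hornerE mulrDl; apply: in_LambdaD.
  by rewrite mulrAC [X in in_Lambda X]mulrC; apply: in_Lambda_theta.
by rewrite /Defs.in_Lambda -(mulr0 (iota c)); apply: exp_valZ.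
Qed.

Lemma in_End_kev a : in_End (kev a). Proof. by move=> l; apply: in_Lambda_kev. Qed.

Lemma in_EndM c d : in_End c -> in_End d -> in_End (c * d).
Proof. by move=> Ec Ed l /Ed/Ec; rewrite mulrA. Qed.

Lemma in_EndN c : in_End c -> in_End (- c).
Proof.
move=> Ec; have -> : - c = kev (0 - 1) * c by rewrite kevB kev0 kev1 sub0r mulN1r.
exact: in_EndM (@in_End_kev _) Ec.
Qed.

Lemma in_EndB c d : in_End c -> in_End d -> in_End (c - d).
Proof.
move=> Ec Ed l ll; rewrite mulrBl -mulNr; apply: in_LambdaD; first exact: Ec.
exact: in_EndN.
Qed.

Lemma in_End_prod (I : finType) (P : pred I) (d : I -> C) :
  (forall i, in_End (d i)) -> in_End (\prod_(i | P i) d i).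
Proof.
by move=> Ed; elim/big_ind: _ => //; [rewrite -kev1; apply: in_End_kev | apply: in_EndM].
Qed.

Lemma in_Krho_End c : in_End c -> in_Krho c.
Proof.
move=> Ec; exists c, 1; split=> //; last by rewrite divr1.
  by rewrite -kev1; apply: in_End_kev.
exact: oner_neq0.
Qed.

Lemma in_Krho0 : in_Krho 0. Proof. by rewrite -kev0; apply/in_Krho_End/in_End_kev. Qed.

Lemma in_Krho1 : in_Krho 1. Proof. by rewrite -kev1; apply/in_Krho_End/in_End_kev. Qed.

Lemma in_KrhoB x y : in_Krho x -> in_Krho y -> in_Krho (x - y).
Proof.
move=> [a [b [Ea Eb b0 ->]]] [c [d [Ec Ed d0 ->]]]; exists (a * d - c * b), (b * d).
split; rewrite ?mulf_neq0 //; last by rewrite -mulNr addf_div // mulNr.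
  by apply: in_EndB; apply: in_EndM.
exact: in_EndM.
Qed.

Lemma in_KrhoM x y : in_Krho x -> in_Krho y -> in_Krho (x * y).
Proof.
move=> [a [b [Ea Eb b0 ->]]] [c [d [Ec Ed d0 ->]]]; exists (a * c), (b * d).
by split; rewrite ?mulf_neq0 // ?mulf_div //; apply: in_EndM.
Qed.

Lemma in_KrhoV x : in_Krho x -> in_Krho x^-1.
Proof.
move=> [a [b [Ea Eb b0 ->]]]; have [a0|a0] := eqVneq a 0.
  by rewrite a0 mul0r invr0; apply: in_Krho0.
by exists b, a; rewrite invf_div.
Qed.

Lemma in_Krho_k x : in_k x -> in_Krho x.
Proof. by move=> [a [b [b0 ->]]]; exists (kev a), (kev b); split=> //; apply: in_End_kev. Qed.

Lemma in_Krho_common_denominator (I : finType) (y : I -> C) :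
  (forall i, in_Krho (y i)) -> exists2 D, D != 0 & forall i, in_End (D * y i).
Proof.
move=> Ky; have /fin_all_exists[d dP] i : exists d, [/\ in_End d, d != 0 & in_End (d * y i)].
  have [c [d [Ec Ed d0 ->]]] := Ky i; exists d; split=> //.
  by rewrite mulrC divfK.
have Ed i : in_End (d i) by case: (dP i).
exists (\prod_i d i); first by apply/prodf_neq0 => i _; case: (dP i).
move=> i; rewrite (bigD1 i) //= mulrAC; apply: in_EndM; first by case: (dP i).
exact: in_End_prod.
Qed.

(* Multiplying a K_rho-basis of the span by a k-basis of K_rho gives s(r/s + n)
   elements independent over k. If some u_i were eliminated, a common multiple
   of them would lie in the k-span of r + s(n - 1) elements; this compares
   dimensions over k only, and never needs that s divides r. *)
Lemma dim_span_no_relation (omega : 'I_r -> C) (s n : nat) (u x : 'I_n -> C) :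
  is_A_basis iota theta abs ec omega -> K_dim in_k in_Krho s ->
  K_dim in_Krho (K_comb in_Krho (fun i : 'I_(r + n) =>
      match split i with inl j => omega j | inr j => u j end)) (r %/ s + n)%N ->
  (forall i, in_End (x i)) -> in_Lambda (\sum_i x i * u i) -> forall i, x i = 0.
Proof.
move=> [omL Lspan _] [e [Ke e_indep e_span]] [b [b_comb b_indep _]] Ex Lxu i0.
apply/eqP/contraT => x0; case: n => [|n] in u x b b_comb b_indep Ex Lxu i0 x0 *; first by case: i0 x0.
have [a xuE] := Lspan _ Lxu.
(* With [s = 0] the empty family would span 1. *)
have s0 : (0 < s)%N.
  case: s e {Ke e_indep} e_span {b b_comb b_indep} => // e /(_ 1 in_Krho1)[c [_]].
  by rewrite big_ord0 => /eqP; rewrite oner_eq0.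
have Kx i : in_Krho (x i) by apply: in_Krho_End.
have uE : u i0 = \sum_j kev (a j) / x i0 * omega j -
    \sum_i x (lift i0 i) / x i0 * u (lift i0 i).
  apply: (mulfI x0); rewrite mulrBr !mulr_sumr.
  under eq_bigr => j _ do rewrite mulrA [x i0 * _]mulrC divfK //.
  under [X in _ - X]eq_bigr => j _ do rewrite mulrA [x i0 * _]mulrC divfK //.
  by rewrite -xuE (bigD1_ord i0) //= addrK.
have /fin_all_exists[p /fin_all_exists[g pg]] : forall l, exists p : 'I_r -> C, exists g : 'I_n -> C,
    [/\ forall j, in_Krho (p j), forall i, in_Krho (g i)
      & b l = \sum_j p j * omega j + \sum_i g i * u (lift i0 i)].
  move=> l; have [c [Kc bE]] := b_comb l.
  exists (fun j => c (lshift _ j) - - c (rshift _ i0) * (kev (a j) / x i0)).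
  exists (fun i => c (rshift _ (lift i0 i)) - c (rshift _ i0) * (x (lift i0 i) / x i0)).
  have Kq y : in_Krho y -> in_Krho (c (rshift _ i0) * (y / x i0)).
    by move=> Ky; apply: in_KrhoM => //; apply: in_KrhoM => //; apply: in_KrhoV.
  split=> [j|i|].
  - rewrite mulNr opprK -[X in _ + X]opprK -[- (c _ * _)]add0r.
    by do 2![apply: in_KrhoB => //]; [apply: in_Krho0 | apply/Kq/in_Krho_End/in_End_kev].
  - by apply: in_KrhoB => //; apply: Kq.
  rewrite bE big_split_ord /= (eq_bigr (fun j => c (lshift _ j) * omega j)); last first.
    by move=> j _; rewrite (unsplitK (inl j)).
  rewrite [X in _ + X](eq_bigr (fun i => c (rshift _ i) * u i)); last first.
    by move=> j _; rewrite (unsplitK (inr j)).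
  rewrite (bigD1_ord i0) //= uE mulrBr !mulr_sumr addrA addrA -big_split /=.
  rewrite -addrA -sumrN -big_split; congr (_ + _); apply: eq_bigr => j _ /=.
    by ring.
  by ring.
have Kp l j : in_Krho (p l j) by case: (pg l).
have Kg l i : in_Krho (g l i) by case: (pg l).
(* After scaling by [D], the period part of each product is a sum of lattice elements, hence an
   A-combination of the [omega j]. *)
have [D D0 ED] : exists2 D, D != 0 & forall t : 'I_s * 'I_(r %/ s + n.+1) * 'I_r,
    in_End (D * (e t.1.1 * p t.1.2 t.2)).
  by apply: in_Krho_common_denominator => t; apply: in_KrhoM.
pose y (t : 'I_r + 'I_n * 'I_s) :=
  match t with inl j => omega j | inr (i, a') => D * e a' * u (lift i0 i) end.
(* For the floor [r %/ s] one has $s(\lfloor r/s\rfloor+1)>r$, so the left side exceeds $r+ns$. *)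
suff : (#|{: 'I_s * 'I_(r %/ s + n.+1)}| <= #|{: 'I_r + 'I_n * 'I_s}|)%N.
  rewrite card_sum !card_prod !card_ord.
  by have := ltn_ceil r s0; move: (r %/ s)%N => Q; nia.
apply: (@indep_card_le C in_k in_k0 in_k1 in_kB in_kM in_kV _ _
  (fun t => D * e t.1 * b t.2) y) => [c kc c0 [a' l]|[a' l] /=].
(* Tower argument: the inner sums lie in $K_\rho$ and vanish by independence of [b]; independence of
   [e] over k then kills each coefficient. *)
- have {}c0 : \sum_l (\sum_a' c (a', l) * e a') * b l = 0.
    apply: (mulfI D0); rewrite mulr0 -[RHS]c0 mulr_sumr.
    transitivity (\sum_a' \sum_l c (a', l) * (D * e a' * b l)); last first.
      by rewrite pair_bigA; apply: eq_bigr => -[].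
    rewrite exchange_big /=.
    apply: eq_bigr => l' _; rewrite mulr_suml mulr_sumr; apply: eq_bigr => a'' _; ring.
  apply: (e_indep (fun a' => c (a', l))) => //; move: l.
  apply: b_indep c0 => l; apply: (subfield_sum in_Krho0 in_KrhoB) => a''.
  by apply: in_KrhoM => //; apply: in_Krho_k.
case: (pg l) => _ _ ->; rewrite mulrDr !mulr_sumr; apply: (fin_combD in_k0 in_kB).
  apply: (fin_comb_sum in_k0 in_kB) => j.
  have [aj ->] : exists aj : 'I_r -> {poly F},
      D * e a' * (p l j * omega j) = \sum_j' kev (aj j') * omega j'.
    by apply: Lspan; rewrite !mulrA -[D * _ * _]mulrA; apply: (ED (a', l, j)).
  apply: (fin_comb_sum in_k0 in_kB) => j'; apply: (fin_comb_gen in_k0 y (inl j')).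
  exact: in_k_kev.
apply: (fin_comb_sum in_k0 in_kB) => i.
(* The $K_\rho$-coefficient of each remaining [u] is expanded along the k-basis [e]. *)
have [c [kc ec']] := e_span _ (in_KrhoM (Ke a') (Kg l i)).
have -> : D * e a' * (g l i * u (lift i0 i)) = \sum_(a'' < s) c a'' * (D * e a'' * u (lift i0 i)).
  transitivity (D * (e a' * g l i) * u (lift i0 i)); first by ring.
  rewrite ec' mulr_sumr mulr_suml; apply: eq_bigr => a'' _; ring.
apply: (fin_comb_sum in_k0 in_kB) => a''; exact: (fin_comb_gen in_k0 y (inr (i, a''))).
Qed.

End PeriodLattice.

(** * From a splitting of the extension to a relation among the logarithms *)

Theorem theorem4p2
  (F : finFieldType) (C : closedFieldType) (R : realType)
  (iota : {rmorphism F -> C}) (theta : C) (abs : C -> R)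
  (HC : is_Cinf iota theta abs)
  (r : nat) (r_gt0 : (0 < r)%N) (kappa : nat -> C)
  (Hkappa : forall j, (0 < j < r)%N -> in_kbar iota theta (kappa j))
  (ec : nat -> C) (Hexp : is_exp_coeffs F theta abs r kappa ec)
  (omega : 'I_r -> C) (Homega : is_A_basis iota theta abs ec omega)
  (s : nat) (Hs : K_dim (in_k iota theta) (in_Krho F abs ec) s)
  (n : nat) (u alpha : 'I_n -> C)
  (Hu : forall i, exp_val F abs ec (u i) (alpha i))
  (Halpha : forall i, in_kbar iota theta (alpha i))
  (Hdim : K_dim (in_Krho F abs ec)
            (K_comb (in_Krho F abs ec)
               (fun i : 'I_(r + n) =>
                  match split i with inl j => omega j | inr j => u j end))
            (r %/ s + n)%N) :
  forall E : 'I_n -> 'M[Ct C]_r,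
    (forall i, in_kbart_mx iota theta (E i)) ->
    (exists i, E i != 0) ->
    (forall i, exists Em1, twistm1_mx F (E i) Em1 /\
        Phi_rho F theta r kappa *m E i = Em1 *m Phi_rho F theta r kappa) ->
    ~ (exists gamma gammam1 : 'rV[Ct C]_r,
         [/\ in_kbart_mx iota theta gamma, twistm1_mx F gamma gammam1
           & gammam1 *m Phi_rho F theta r kappa
             + \sum_(i < n) h_tr r (alpha i) *m E i = gamma]).
Proof.
case: r r_gt0 Hkappa Hexp omega Homega Hdim => // m _ _ Hexp omega Homega Hdim.
move=> E _ [i0 Ei0] EP [g [gm1 [_ gg ge]]].
have [P [G [P0 PhiP PG]]] :=
  clear_denominators_system (theta_nonperiodic HC) EP gg ge.
have [_ ex_val _] := Hexp; have [e eP] := choice ex_val.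
have ev_unique z w : exp_val F abs ec z w -> e z = w by exact: exp_val_unique HC _ _ _ _ (eP z).
have eD : {morph e : x y / x + y} by move=> x y; apply: ev_unique; apply: (exp_valD HC).
have e0 : e 0 = 0 by apply/ev_unique/(exp_val0 HC).
(* [b i] is the multiplier through which the operator of [P i] acts on the exponential; it is set to
   0 when [P i] is 0. *)
have /fin_all_exists[b bP] i : exists b, (b = 0 -> P i = 0) /\
    forall z, row_eval iota theta kappa ((e z)%:P *: row ord0 (P i)) = e (b * z).
  have [Pi0|/eqP Pi0] := eqVneq (P i) 0.
    by exists 0; split=> // z; rewrite mul0r e0 Pi0 row0 scaler0 raddf0.
  have [p [pE pz pP pC]] := endomorphism_operator (PhiP i).
  have p0 : p != 0 by apply: contra_not_neq Pi0.
  have [b b0 pe] := exp_operator HC Hexp eP p0 pz pC.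
  by exists b; split=> [/eqP|z]; [rewrite (negPf b0) | rewrite -pE pe].
have bE i z : row_eval iota theta kappa ((e z)%:P *: row ord0 (P i)) = e (b i * z).
  by case: (bP i).
have : b i0 = 0; last by move/(bP i0).1/P0/eqP; rewrite (negPf Ei0).
(* Two facts remain: [b i] preserves periods, because the operator of [P i] sends 0 to 0, and
   $\sum_i b_iu_i$ is a period, because its exponential is the sum in [row_eval_solution]. *)
apply: (dim_span_no_relation HC Hexp Homega Hs Hdim) => [i l ll|].
  have e_l : e l = 0 by apply: ev_unique.
  have := eP (b i * l).
  by rewrite -bE e_l polyC0 scale0r (raddf0 (row_eval (m := m) iota theta kappa)).
have := eP (\sum_i b i * u i); rewrite (big_morph e eD e0).
under eq_bigr => i _ do rewrite -bE (ev_unique _ _ (Hu i)).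
by rewrite (row_eval_solution PG).
Qed.
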